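(* Let $r \geq 2$ and let $\mathcal{F}$ be a family of $r$-graphs. Then \[ \gamma^+(\mathcal{F}) \in \left\{0, \frac{1}{r}\right\} \cup \left[\frac{2}{2r-1}, 1\right]. \] Thus every $\alpha \in [0, \frac{2}{2r-1})$ is a $\gamma^+$-jump. Moreover, $\gamma^+(\mathcal{F}) = 0$ if and only if some member of $\mathcal{F}$ is $r$-partite, and $\gamma^+(\mathcal{F}) = \frac{1}{r}$ if and only if no member of $\mathcal{F}$ is $r$-partite but some member of $\mathcal{F}$ is contained in a blow-up of $T^r$.
   Context: An $r$-graph is a hypergraph all of whose edges have size $r$. For an $r$-graph $H$ and an $(r-1)$-set $S\subseteq V(H)$, the co-degree of $S$ is the number of edges of $H$ containing $S$. The minimum positive co-degree $\delta_{r-1}^+(H)$ is the largest integer $k$ such that every $(r-1)$-set contained in some edge of $H$ is contained in at least $k$ edges of $H$; the edgeless $r$-graph has minimum positive co-degree $0$. For a family $\mathcal{F}$ of $r$-graphs, $\mathrm{co^+ex}(n,\mathcal{F})$ is the maximum of $\delta_{r-1}^+(H)$ over all $n$-vertex $r$-graphs $H$ containing no member of $\mathcal{F}$ as a (not necessarily induced) subhypergraph, and $\gamma^+(\mathcal{F}) = \lim_{n\to\infty} \mathrm{co^+ex}(n,\mathcal{F})/n$ (this limit is known to exist). A value $\alpha\in[0,1)$ is a $\gamma^+$-jump if there is $\delta\in(0,1-\alpha)$ such that no family $\mathcal{F}$ of $r$-graphs has $\gamma^+(\mathcal{F})\in(\alpha,\alpha+\delta)$. An $r$-graph is $r$-partite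 if its vertex set can be partitioned into $r$ classes such that each edge meets each class in at most one vertex. The $t$-blow-up $H[t]$ of an $r$-graph $H$ replaces each vertex $v_i$ by a class $V_i$ of $t$ vertices, and an $r$-set is an edge iff it meets $r$ distinct classes corresponding to an edge of $H$; a blow-up of $H$ is $H[t]$ for some $t$, and ''contained in'' means as a subhypergraph. $T^r$ denotes the $r$-graph with $r+1$ vertices and three edges, obtained from a graph triangle on vertices $x,y,z$ by adding the same $r-2$ new vertices to each of the three edges $xy,yz,xz$. *)

(* Defs.v *)
From HB Require Import structures.
From mathcomp Require Import all_boot all_order all_algebra.
From mathcomp Require Import all_classical all_reals all_analysis.
From mathcomp Require Import finset.

Set Implicit Arguments.
Unset Strict Implicit.
Unset Printing Implicit Defensive.

Import Order.TTheory GRing.Theory Num.Theory numFieldNormedType.Exports.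

Definition uniform (r : nat) (V : finType) (H : {set {set V}}) : bool :=
  [forall e in H, #|e| == r].

Record r_graph (r : nat) := R_graph {
  nb_vertices : nat;
  edges :> {set {set 'I_nb_vertices}};
  edges_uniform : uniform r edges
}.

(* [G] is a (not necessarily induced) subhypergraph of [H], up to renaming. *)
Definition contained_in (V W : finType) (G : {set {set V}}) (H : {set {set W}})
    : Prop :=
  exists2 f : V -> W, injective f & forall e, e \in G -> f @: e \in H.

Definition codegree (V : finType) (H : {set {set V}}) (S : {set V}) : nat :=
  #|[set e in H | S \subset e]|.

Definition codegree_lower_bound (r : nat) (V : finType) (H : {set {set V}})
    (k : nat) : bool :=
  [forall S : {set V}, (#|S| == r.-1) ==> [exists e in H, S \subset e] ==>
     (k <= codegree H S)].

(* No codegree exceeds [#|H|], so bounding [k] by it loses nothing: see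
   [min_pos_codegreeP]. *)
Definition min_pos_codegree (r : nat) (V : finType) (H : {set {set V}}) : nat :=
  if H == set0 then 0
  else \max_(k < #|H|.+1 | codegree_lower_bound r H k) k.

Lemma min_pos_codegreeP (r : nat) (V : finType) (H : {set {set V}}) (k : nat) :
  H != set0 -> uniform r H ->
  (k <= min_pos_codegree r H) = codegree_lower_bound r H k.
Proof.
move=> H0 /forall_inP uH; rewrite /min_pos_codegree (negbTE H0).
have down j i : j <= i ->
    codegree_lower_bound r H i -> codegree_lower_bound r H j.
  move=> ji /forallP Hi; apply/forallP => S; apply/implyP => cS; apply/implyP => eS.
  by apply: leq_trans ji _; move: (Hi S); rewrite cS eS.
apply/idP/idP => [|Hk].
  move/down; apply; elim/big_ind: _ => // [|x y Hx Hy].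
    by apply/forallP => S; apply/implyP => _; apply/implyP.
  by rewrite /maxn; case: ifP.
suff kH : k < #|H|.+1 by apply: (leq_bigmax_cond (Ordinal kH)).
have [e eH] := set0Pn _ H0.
have [S Se cS] : exists2 S : {set V}, S \subset e & #|S| = r.-1.
  have [e0|[x xe]] := set_0Vmem e.
    by exists set0; rewrite ?sub0set // cards0 -(eqP (uH e eH)) e0 cards0.
  exists (e :\ x); first exact: subsetDl.
  by rewrite -(eqP (uH e eH)) (cardsD1 x e) xe.
move/forallP/(_ S): Hk; rewrite cS eqxx /=.
have -> /= : [exists e in H, S \subset e] by apply/exists_inP; exists e.
move=> /leq_trans; apply; apply: subset_leq_card.
by apply/fintype.subsetP => e'; rewrite inE => /andP[].
Qed.

Definition family_free (r : nat) (F : set (r_graph r)) (V : finType)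
    (H : {set {set V}}) : Prop :=
  forall G : r_graph r, F G -> ~ contained_in G H.

(* The maximum is 0 when there is no [F]-free [r]-graph on [n] vertices, which
   for large [n] happens exactly when [F] has an edgeless member. *)
Definition coex (r : nat) (F : set (r_graph r)) (n : nat) : nat :=
  \max_(H : {set {set 'I_n}} | uniform r H && `[< family_free F H >])
     min_pos_codegree r H.

(* Classes may be empty. *)
Definition partite (r : nat) (V : finType) (H : {set {set V}}) : Prop :=
  exists c : V -> 'I_r,
    forall e, e \in H -> forall i, #|[set v in e | c v == i]| <= 1.

(* The class of [v] is the set of pairs [(v, i)].  If [H] is [r]-uniform, an
   [r]-set projecting onto an edge meets [r] distinct classes. *)
Definition blowup (r : nat) (V : finType) (H : {set {set V}}) (t : nat)
    : {set {set V * 'I_t}} :=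
  [set e : {set V * 'I_t} | (#|e| == r) && ([set x.1 | x in e] \in H)].

(* [T^r], for [r >= 2]: the triangle lives on ['I_3], the [r - 2] common
   vertices on ['I_(r - 2)]. *)
Definition Tgraph (r : nat) : {set {set 'I_3 + 'I_(r - 2)}} :=
  [set [set inl x | x in p] :|: [set inr y | y in [set: 'I_(r - 2)]]
     | p : {set 'I_3} in [set p : {set 'I_3} | #|p| == 2]].

Lemma uniform_Tgraph (r : nat) : 2 <= r -> uniform r (Tgraph r).
Proof.
move=> r2; apply/forall_inP => _ /imsetP[p + ->]; rewrite inE => /eqP cp.
rewrite cardsU disjoint_setI0 ?cards0 ?subn0; last first.
  rewrite disjoints_subset; apply/fintype.subsetP => _ /imsetP[x _ ->].
  by rewrite inE; apply/imsetP => -[].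
by rewrite !card_imset ?cp ?cardsT ?card_ord ?subnKC // => x y [].
Qed.

Local Open Scope ring_scope.

(* The limit is known to exist; [limn] of a divergent sequence is the junk value 0,
   which would contradict the characterization of [gamma_plus R F = 0]. *)
Definition gamma_plus (R : realType) (r : nat) (F : set (r_graph r)) : R :=
  limn (fun n : nat => (coex F n)%:R / n%:R : R).

Definition gamma_plus_jump (R : realType) (r : nat) (alpha : R) : Prop :=
  0 <= alpha < 1 /\
  exists2 delta : R, 0 < delta < 1 - alpha &
    forall F : set (r_graph r), ~ (alpha < gamma_plus R F < alpha + delta).

(* Main.v *)
(* Upper bounds.  If every positive codegree is at least [k], then an edge can be
   rebuilt one vertex at a time, so there are at least [k ^ r] ordered edges;
   when [k >= eps * n] this is a positive density and Erdos' theorem yields every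
   [r]-partite subgraph.  If moreover [k >= (1 / r + eps) * n], the links of the
   [r] facets of an edge have total size at least [(1 + r * eps) * n], so at
   least [eps * n] vertices lie in two of these links; this gives a positive
   density of copies of [T^r], hence, by Erdos' theorem again, all blow-ups of
   [T^r].
   Lower bounds.  Balanced complete [r]-partite graphs have codegree [n / r]; the
   blow-up of [T^r] giving each of the [r - 2] common vertices twice the weight
   of a triangle vertex has all positive codegrees about [2 n / (2 r - 1)].
   The limit exists because a random set of [m] vertices containing a fixed edge
   almost preserves, by Chernoff's bound, all positive codegrees of an [n]-vertex
   graph with [n] much larger than [m]. *)
Require Import Defs.
From mathcomp Require Import all_boot all_order all_algebra.
From mathcomp Require Import all_classical all_reals all_analysis.
From mathcomp Require Import fintype finset ring lra zify.

Set Implicit Arguments.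
Unset Strict Implicit.
Unset Printing Implicit Defensive.

Import Order.TTheory GRing.Theory Num.Theory numFieldNormedType.Exports.
Local Open Scope ring_scope.

(** * Dense relations contain boxes *)

Section TupleSums.
Variables (R : realType) (V : finType).
Implicit Types (f g : seq V -> R) (k t : nat).

(** Tuples are plain sequences, so that induction on [k] peels off first coordinates without casts;
    with a 0/1 integrand this counts sequences. *)
Fixpoint tsum k f : R :=
  if k is k'.+1 then \sum_(v : V) tsum k' (fun s => f (v :: s)) else f [::].

Lemma eq_tsum k f g :
  (forall s, size s = k -> f s = g s) -> tsum k f = tsum k g.
Proof.
elim: k f g => [|k IH] f g fg /=; first exact: fg.
by apply: eq_bigr => v _; apply: IH => s ss; apply: fg; rewrite /= ss.
Qed.

Lemma ler_tsum k f g :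
  (forall s, size s = k -> f s <= g s) -> tsum k f <= tsum k g.
Proof.
elim: k f g => [|k IH] f g fg /=; first exact: fg.
by apply: ler_sum => v _; apply: IH => s ss; apply: fg; rewrite /= ss.
Qed.

Lemma tsum_const k (c : R) : tsum k (fun=> c) = c * #|V|%:R ^+ k.
Proof.
elim: k => [|k IH] /=; first by rewrite mulr1.
by rewrite IH sumr_const exprS mulrCA mulr_natl.
Qed.

Lemma tsumD k f g : tsum k (fun s => f s + g s) = tsum k f + tsum k g.
Proof.
elim: k f g => [|k IH] f g //=; rewrite -big_split.
by apply: eq_bigr => v _; exact: IH.
Qed.

Lemma tsumZ k (c : R) f : tsum k (fun s => c * f s) = c * tsum k f.
Proof.
elim: k f => [|k IH] f //=; rewrite mulr_sumr.
by apply: eq_bigr => v _; exact: IH.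
Qed.

Lemma tsum_sum k (I : finType) (P : pred I) (F : I -> seq V -> R) :
  tsum k (fun s => \sum_(i | P i) F i s) = \sum_(i | P i) tsum k (F i).
Proof.
elim: k F => [|k IH] F //=; rewrite exchange_big /=.
by apply: eq_bigr => v _; exact: IH.
Qed.

Lemma exchange_tsum k t (F : seq V -> seq V -> R) :
  tsum k (fun s => tsum t (F s)) = tsum t (fun u => tsum k (F^~ u)).
Proof.
elim: t F => [|t IH] F //=.
by rewrite tsum_sum; apply: eq_bigr => v _; rewrite IH.
Qed.

Lemma tsum_all t (b : pred V) :
  tsum t (fun u => (all b u)%:R) = (\sum_v (b v)%:R) ^+ t.
Proof.
elim: t => [|t IH] //=; rewrite exprS mulr_suml.
apply: eq_bigr => v _; rewrite -IH -tsumZ; apply: eq_tsum => s _.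
by rewrite -natrM mulnb.
Qed.

Lemma sum_mem_le (s : seq V) : \sum_v (v \in s)%:R <= (size s)%:R :> R.
Proof.
rewrite -natr_sum ler_nat; apply: leq_trans (card_size s).
by rewrite -sum1_card [leqRHS]big_mkcond; apply: leq_sum => v _; case: ifP.
Qed.

(** Union bound: a repetition either involves the head, which then has at most [t] choices, or lies
    in the tail. Thus non-injective tuples are a fraction O(1 / |V|) of all tuples. *)
Lemma tsum_nuniq t :
  #|V|%:R * tsum t (fun u => (~~ uniq u)%:R) <= t%:R ^+ 2 * #|V|%:R ^+ t.
Proof.
set n : R := #|V|%:R; have n0 : 0 <= n by exact: ler0n.
elim: t => [|t IH] /=; first by rewrite mulr0 expr2 !mul0r.
have : \sum_v tsum t (fun s => (~~ ((v \notin s) && uniq s))%:R) <=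
       t%:R * n ^+ t + n * tsum t (fun u => (~~ uniq u)%:R).
  apply: (@le_trans _ _ (\sum_v tsum t (fun s => (v \in s)%:R + (~~ uniq s)%:R))).
    apply: ler_sum => v _; apply: ler_tsum => s _; rewrite -natrD ler_nat.
    by rewrite negb_and negbK; case: (_ \in _).
  rewrite -tsum_sum (eq_tsum (g := fun s => \sum_v (v \in s)%:R + n * (~~ uniq s)%:R)); last first.
    by move=> s _; rewrite big_split /= sumr_const mulr_natl.
  rewrite tsumD tsumZ lerD2r -tsum_const; apply: ler_tsum => s <-.
  exact: sum_mem_le.
move=> /(ler_wpM2l n0) /le_trans; apply.
have : n * (n * tsum t (fun u => (~~ uniq u)%:R)) <= n * (t%:R ^+ 2 * n ^+ t).
  by rewrite ler_wpM2l.
have x0 : 0 <= n ^+ t by exact: exprn_ge0.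
rewrite (exprS n) -(natr1 t) mulrDr => h; apply: (le_trans (lerD (lexx _) h)).
have t0 : (0 : R) <= t%:R by exact: ler0n.
rewrite -subr_ge0 (_ : _ - _ = n * n ^+ t * (t%:R + 1)); last by ring.
by rewrite !mulr_ge0 // addr_ge0.
Qed.

End TupleSums.

Lemma natr_unbounded (R : realType) (x : R) : exists N, forall n, (N <= n)%N -> x < n%:R.
Proof.
exists (Num.bound `|x|) => n hn; apply: (le_lt_trans (ler_norm x)).
by apply: (lt_le_trans (archi_boundP (normr_ge0 x))); rewrite ler_nat.
Qed.

(* Erdos' theorem.  Induction on [k]: some repetition-free [t]-tuple [u] of first
   coordinates has a positive density of common extensions, by convexity of
   [d ^ t] in the number [d s] of first coordinates extending [s]. *)
Lemma box_of_density (R : realType) (k t : nat) (c : R) : 0 < c ->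
  exists N, forall (V : finType) (P : pred (seq V)), (N <= #|V|)%N ->
    c * #|V|%:R ^+ k <= tsum k (fun s => (P s)%:R) ->
  exists g : nat -> nat -> V,
    (forall i, (i < k)%N -> {in gtn t &, injective (g i)}) /\
    forall a : nat -> nat, (forall i, (i < k)%N -> (a i < t)%N) ->
      P (mkseq (fun i => g i (a i)) k).
Proof.
elim: k c => [|k IH] c c0.
  exists 1%N => V P /card_gt0P[v _] /=; rewrite mulr1 => cP.
  exists (fun _ _ => v); split=> // a _; rewrite /mkseq /=.
  by case: (P [::]) cP => //; rewrite leNgt c0.
(* Half of the density: summing the minorant [key] over [s] leaves [c - x0 = x0], which gives the
   constant [c1]. *)
have [x0 x00 cE] : exists2 x0 : R, 0 < x0 & c = 2 * x0.
  by exists (c / 2); [rewrite divr_gt0|field].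
pose c1 := x0 ^+ t.+1; have c10 : 0 < c1 by exact: exprn_gt0.
have [N1 HN1] := IH (c1 / 2) (divr_gt0 c10 (ltr0Sn _ 1)).
have [N2 HN2] := natr_unbounded (2 * t%:R ^+ 2 / c1).
exists (maxn 1 (maxn N1 N2)) => V P; rewrite !geq_max => /and3P[n0 nN1 nN2].
set n : R := #|V|%:R => dens.
have np : 0 < n by rewrite ltr0n.
pose d s : R := \sum_v (P (v :: s))%:R.
have d0 s : 0 <= d s by apply: sumr_ge0 => v _; exact: ler0n.
have dn s : d s <= n.
  apply: (@le_trans _ _ (\sum_(v : V) 1)); last by rewrite sumr_const.
  by apply: ler_sum => v _; rewrite lern1 leq_b1.
(* A linear minorant of [d ^ t], which replaces Jensen's inequality. *)
have key s : (x0 * n) ^+ t * (d s - x0 * n) <= n * d s ^+ t.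
  have x0n : 0 <= x0 * n by rewrite mulr_ge0 // ltW.
  have [dx|dx] := leP (d s) (x0 * n).
    apply: (@le_trans _ _ 0); first by rewrite mulr_ge0_le0 ?subr_le0 // exprn_ge0.
    by rewrite mulr_ge0 ?exprn_ge0 // ltW.
  rewrite mulrC; apply: ler_pM; rewrite ?subr_ge0 ?exprn_ge0 ?(ltW dx) //.
    by rewrite lerBlDr (le_trans (dn s)) // lerDl.
  by rewrite lerXn2r ?nnegrE // ltW.
have total : c1 * n ^+ (k + t) <= tsum t (fun u => tsum k (fun s => (all (fun v => P (v :: s)) u)%:R)).
  rewrite -exchange_tsum.
  rewrite (eq_tsum (g := fun s => d s ^+ t)); last by move=> s _; rewrite tsum_all.
  have : tsum k (fun s => (x0 * n) ^+ t * (d s - x0 * n)) <= n * tsum k (fun s => d s ^+ t).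
    by rewrite -tsumZ; apply: ler_tsum.
  rewrite tsumZ tsumD tsum_const => h.
  rewrite -(ler_pM2l np); apply: le_trans h.
  have -> : tsum k d = tsum k.+1 (fun s => (P s)%:R) by rewrite /d tsum_sum.
  have -> : n * (c1 * n ^+ (k + t)) = (x0 * n) ^+ t * (c * n ^+ k.+1 - x0 * n * n ^+ k).
    by rewrite cE /c1 exprMn exprD !exprS; ring.
  rewrite ler_wpM2l ?exprn_ge0 ?mulr_ge0 ?(ltW x00) ?(ltW np) // mulNr lerD2r.
  exact: dens.
(* Otherwise [total] fails: repetition-free [u] would contribute less than [c1 / 2 * n ^ k] each,
   and the others, at most [n ^ k] each, are too few once [n] exceeds [2 * t ^ 2 / c1]. *)
have [u us [uu Hu]] : exists2 u, size u = t & uniq u /\ c1 / 2 * n ^+ k <= tsum k (fun s => (all (fun v => P (v :: s)) u)%:R).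
  apply: contrapT => H; move: total; apply/negP; rewrite -ltNge.
  apply: (@le_lt_trans _ _ (tsum t (fun u : seq V => c1 / 2 * n ^+ k + n ^+ k * (~~ uniq u)%:R))).
    apply: ler_tsum => u us; have [uu|uu] /= := boolP (uniq u).
      rewrite mulr0 addr0; apply/ltW; rewrite ltNge; apply/negP => h.
      by apply: H; exists u.
    rewrite mulr1; apply: (@le_trans _ _ (n ^+ k)); last first.
      by rewrite lerDr mulr_ge0 ?exprn_ge0 ?divr_ge0 ?(ltW c10) ?(ltW np).
    rewrite -[leRHS]mul1r -tsum_const; apply: ler_tsum => s _.
    by rewrite lern1 leq_b1.
  rewrite tsumD tsum_const tsumZ -/n.
  rewrite [in ltRHS](splitr c1) mulrDl exprD -mulrA ltrD2l.
  rewrite -(ltr_pM2l np) [ltLHS]mulrCA.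
  apply: (@le_lt_trans _ _ (n ^+ k * (t%:R ^+ 2 * n ^+ t))).
    by rewrite ler_wpM2l ?exprn_ge0 ?(ltW np) ?tsum_nuniq.
  have := HN2 _ nN2; rewrite -/n ltr_pdivrMr // => h.
  rewrite -subr_gt0 (_ : _ - _ = n ^+ k * n ^+ t * (n * c1 - 2 * t%:R ^+ 2) / 2); last by field.
  by rewrite !(mulr_gt0, exprn_gt0) ?subr_gt0 // invr_gt0.
have [g' [g'i g'P]] := HN1 V _ nN1 Hu.
have [v0 _] := card_gt0P n0.
exists (fun i => if i is i'.+1 then g' i' else nth v0 u); split.
  case=> [|i] /= ik; last exact: g'i.
  move=> i j; rewrite !inE => it jt /eqP; rewrite nth_uniq ?us // => /eqP //.
move=> a ha; rewrite /mkseq /= (iotaDl 1 0) -map_comp.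
have /allP := g'P (fun i => a i.+1) (fun i ik => ha i.+1 ik); apply.
by rewrite mem_nth // us ha.
Qed.

(** * Links and ordered edges *)

Section Codegree.
Variables (r : nat) (V : finType) (H : {set {set V}}).
Hypotheses (r0 : (0 < r)%N) (uH : uniform r H).
Implicit Types (S e : {set V}) (s p : seq V).

Definition link S : {set V} := [set v | (v \notin S) && (v |: S \in H)].

Lemma card_edge e : e \in H -> #|e| = r.
Proof. by move=> /(forall_inP uH)/eqP. Qed.

Lemma codegreeE S : #|S| = r.-1 -> codegree H S = #|link S|.
Proof.
move=> cS; rewrite /codegree.
have -> : [set e in H | S \subset e] = [set v |: S | v in link S].
  apply/setP => e; rewrite inE; apply/andP/imsetP => [[eH Se]|[v]].
    have : #|e :\: S| == 1%N.
      by rewrite cardsD (setIidPr Se) cS (card_edge eH); case: (r) r0 => // n _; rewrite subSnn.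
    move=> /cards1P[v ev].
    have eE : e = v |: S by rewrite -ev setUC -{1}(setID e S) (setIidPr Se).
    have : v \in e :\: S by rewrite ev set11.
    by rewrite inE => /andP[vS ve]; exists v; rewrite // inE vS -eE.
  by rewrite inE => /andP[vS vH] ->; rewrite vH subsetUr.
rewrite card_in_imset // => v w; rewrite !inE => /andP[vS _] /andP[wS _] vw.
have : v \in w |: S by rewrite -vw setU11.
by rewrite !inE (negbTE vS) orbF => /eqP.
Qed.

Lemma link_lower_bound k S e : codegree_lower_bound r H k -> #|S| = r.-1 ->
  e \in H -> S \subset e -> (k <= #|link S|)%N.
Proof.
move=> /forallP/(_ S) + cS eH Se; rewrite cS eqxx codegreeE //=.
by move/implyP; apply; apply/exists_inP; exists e.
Qed.

Lemma link_lower_boundP k :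
  (forall S e, #|S| = r.-1 -> e \in H -> S \subset e -> (k <= #|link S|)%N) ->
  codegree_lower_bound r H k.
Proof.
move=> h; apply/forallP => S; apply/implyP => /eqP cS; apply/implyP.
by case/exists_inP => e eH Se; rewrite codegreeE // (h S e).
Qed.

Lemma min_pos_codegree_le : (min_pos_codegree r H <= #|V|)%N.
Proof.
have [->|H0] := eqVneq H set0; first by rewrite /min_pos_codegree eqxx.
have [e eH] := set0Pn _ H0.
have : (0 < #|e|)%N by rewrite (card_edge eH).
case/card_gt0P => x xe.
have := @link_lower_bound (min_pos_codegree r H) (e :\ x) e.
rewrite -min_pos_codegreeP // leqnn => /(_ isT) h.
apply: (leq_trans (h _ eH (subsetDl _ _))); last exact: max_card.
by rewrite -(card_edge eH) (cardsD1 x e) xe.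
Qed.

Definition ordered_edge s := uniq s && ([set x in s] \in H).

(** In [claim], a list [p] inside an edge, with [j] vertices missing, is put in a facet [S] of that
    edge; each of the at least [k] vertices of [link S] extends [p] to a list that again lies in an
    edge. *)
Lemma tsum_ordered_edge (R : realType) k : H != set0 -> codegree_lower_bound r H k ->
  k%:R ^+ r <= tsum r (fun s => (ordered_edge s)%:R) :> R.
Proof.
move=> H0 Hk.
have claim j p : uniq p -> (size p + j)%N = r ->
    (exists2 e, e \in H & [set x in p] \subset e) ->
    k%:R ^+ j <= tsum j (fun s => (ordered_edge (s ++ p))%:R) :> R.
  elim: j p => [|j IH] p up sp [e eH pe] /=.
    rewrite /ordered_edge up /= (_ : [set x in p] = e) ?eH //.
    apply/eqP; rewrite eqEcard pe (card_edge eH) cardsE.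
    by move/card_uniqP: up => ->; rewrite -sp addn0 leqnn.
  have [S cS /andP[pS Se]] : exists2 S : {set V}, #|S| = r.-1 & ([set x in p] \subset S) && (S \subset e).
    have cp : #|[set x in p]| = size p by rewrite cardsE; apply/card_uniqP.
    have : (0 < #|e :\: [set x in p]|)%N.
      rewrite cardsD (setIidPr pe) (card_edge eH) cp -sp; lia.
    case/card_gt0P => x; rewrite inE => /andP[xp xe].
    exists (e :\ x); first by rewrite -(card_edge eH) (cardsD1 x e) xe.
    by rewrite subsetD1 pe xp subsetDl.
  have kS := link_lower_bound Hk cS eH Se.
  rewrite exprS; apply: (@le_trans _ _ (\sum_(v in link S) k%:R ^+ j)).
    by rewrite sumr_const -[leRHS]mulr_natl ler_wpM2r ?exprn_ge0 // ler_nat.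
  rewrite [leRHS](bigID (mem (link S))) /= -[leLHS]addr0 lerD //; last first.
    apply: sumr_ge0 => v _; rewrite -[leLHS](@mul0r _ (#|V|%:R ^+ j)) -tsum_const.
    by apply: ler_tsum => s _; exact: ler0n.
  apply: ler_sum => v; rewrite inE => /andP[vS vSH].
  rewrite (eq_tsum (g := fun s => (ordered_edge (s ++ v :: p))%:R)); last first.
    move=> s _; congr (nat_of_bool _)%:R; rewrite /ordered_edge.
    have pE : perm_eq (s ++ v :: p) (v :: s ++ p) by rewrite perm_catC /= perm_cons perm_catC.
    rewrite (perm_uniq pE); congr (_ && (_ \in H)).
    by apply/setP => x; rewrite !inE (perm_mem pE) inE.
  apply: IH => /=; last 2 first.
  - by rewrite -sp addnS addSn.
  - exists (v |: S) => //; apply/fintype.subsetP => x; rewrite !inE.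
    by case/predU1P => [->|xp]; rewrite ?eqxx // (fintype.subsetP pS) ?orbT // inE.
  by rewrite up andbT; apply: contra vS => vp; apply: (fintype.subsetP pS); rewrite inE.
have [e eH] := set0Pn _ H0.
have := @claim r [::] isT (add0n r); rewrite (eq_tsum (g := fun s => (ordered_edge s)%:R)).
  by apply; exists e => //; apply/fintype.subsetP => x; rewrite inE.
by move=> s _; rewrite cats0.
Qed.

End Codegree.

(** A vertex [x] is sent to the element of index [enum_rank x] in side [c x] of the box. Vertices of
    equal colour are separated by injectivity of [g], those of different colours by [uniq]; an edge
    has at most one vertex per colour, so it lies on a single tuple of the box. *)
Lemma box_contained (U V : finType) (G : {set {set U}}) (H : {set {set V}})
    (k : nat) (c : U -> nat) (P : pred (seq V)) (x0 : V) (g : nat -> nat -> V) :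
  (forall x, (c x < k)%N) ->
  (forall e, e \in G -> {in e &, injective c}) ->
  (forall s, size s = k -> P s -> uniq s) ->
  (forall s e, size s = k -> P s -> e \in G -> [set nth x0 s (c x) | x in e] \in H) ->
  (forall i, (i < k)%N -> {in gtn #|U|.+1 &, injective (g i)}) ->
  (forall a : nat -> nat, (forall i, (i < k)%N -> (a i < #|U|.+1)%N) ->
     P (mkseq (fun i => g i (a i)) k)) ->
  contained_in G H.
Proof.
move=> ck cI Pu PH gI gP.
have rk (x : U) : (enum_rank x < #|U|.+1)%N by rewrite ltnS ltnW.
exists (fun x => g (c x) (enum_rank x)) => [x y gxy|e eG].
  have [cxy|cxy] := eqVneq (c x) (c y).
    rewrite cxy in gxy; apply/enum_rank_inj/val_inj.
    by apply: (gI _ (ck y)) gxy; rewrite inE.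
  pose a i : nat := if i == c x then enum_rank x else enum_rank y.
  have /Pu : P (mkseq (fun i => g i (a i)) k).
    by apply: gP => i _; rewrite /a; case: ifP.
  rewrite size_mkseq => /(_ erefl) us.
  have := nth_uniq x0 _ _ us; rewrite size_mkseq => /(_ _ _ (ck x) (ck y)).
  have ax : a (c x) = enum_rank x by rewrite /a eqxx.
  have ay : a (c y) = enum_rank y by rewrite /a eq_sym (negbTE cxy).
  by rewrite !nth_mkseq // ax ay gxy eqxx (negbTE cxy).
(* Colours missing from [e] get the default index 0, legal even for empty [U] because the box has
   width [#|U|.+1]. *)
pose a i : nat := if [pick x in e | c x == i] is Some x then enum_rank x else 0.
have Pa : P (mkseq (fun i => g i (a i)) k).
  by apply: gP => i _; rewrite /a; case: pickP.
have := PH _ _ (size_mkseq _ _) Pa eG.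
congr (_ \in H); apply: eq_in_imset => x xe; rewrite nth_mkseq // /a.
case: pickP => [y /andP[ye /eqP cyx]|/(_ x)]; last by rewrite xe eqxx.
by rewrite (cI e eG y x ye xe cyx).
Qed.

Lemma codegree_free_partite (R : realType) (r : nat) (G : r_graph r) (eps : R) :
  (0 < r)%N -> partite r G -> 0 < eps ->
  exists N, forall (V : finType) (H : {set {set V}}), (N <= #|V|)%N ->
    uniform r H -> ~ contained_in G H ->
    (min_pos_codegree r H)%:R <= eps * #|V|%:R.
Proof.
move=> r0 [c cP] eps0.
have [N HN] := box_of_density r (nb_vertices G).+1 (exprn_gt0 r eps0).
exists (maxn 1 N) => V H; rewrite geq_max => /andP[/card_gt0P[x0 _] nN] uH GH.
rewrite leNgt; apply/negP => hk; apply: GH.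
have H0 : H != set0.
  apply/eqP => H0; move: hk; rewrite H0 /min_pos_codegree eqxx ltNge.
  by rewrite mulr_ge0 // ltW.
have Hk : codegree_lower_bound r H (min_pos_codegree r H) by rewrite -min_pos_codegreeP.
have [|g [gI gP]] := HN V (ordered_edge H) nN.
  apply: le_trans (tsum_ordered_edge r0 uH R H0 Hk); rewrite -exprMn.
  by rewrite lerXn2r ?nnegrE ?(ltW hk) // mulr_ge0 // ltW.
have cI e : e \in edges G -> {in e &, injective (fun x => c x : nat)}.
  move=> eG x y xe ye /val_inj cxy.
  by have /card_le1_eqP := cP e eG (c y); apply; rewrite inE ?xe ?ye ?cxy eqxx.
apply: (@box_contained _ _ _ _ r c (ordered_edge H) x0 g) => //.
- by move=> s _ /andP[].
- move=> s e ss /andP[us sH] eG.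
  suff -> : [set nth x0 s (c x) | x in e] = [set x in s] by [].
  apply/eqP; rewrite eqEcard; apply/andP; split.
    by apply/fintype.subsetP => _ /imsetP[x _ ->]; rewrite inE mem_nth // ss.
  rewrite card_in_imset => [|x y xe ye /eqP]; last first.
    by rewrite nth_uniq ?ss // => /eqP; exact: (cI e eG).
  by rewrite cardsE (card_edge (edges_uniform G) eG) -ss card_size.
- by rewrite card_ord.
- by move=> a ha; apply: gP => i /ha; rewrite card_ord.
Qed.

(** * Blow-ups of the triangle graph *)

(** A pair in the triangle is the complement of one vertex, so each edge of [T^r] omits exactly one
    triangle vertex. This form drives all later computations. *)
Lemma TgraphE (r : nat) : Tgraph r = [set ~: [set inl a] | a : 'I_3].
Proof.
have compl_pair (p : {set 'I_3}) (a : 'I_3) : p = [set~ a] ->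
    [set inl x | x in p] :|: [set inr y | y in [set: 'I_(r - 2)]] = ~: [set inl a].
  move=> ->; apply/setP => -[x|y]; rewrite !inE.
    rewrite mem_imset ?inE => [|? ? []] //; rewrite orbC.
    by case: imsetP => [[]|//].
  by rewrite orbC mem_imset ?inE // => ? ? [].
apply/setP => e; apply/imsetP/imsetP => [[p]|[a _ ->]].
  rewrite inE => /eqP cp ->.
  have : #|~: p| == 1%N by rewrite cardsCs setCK cp card_ord.
  by case/cards1P => a pa; exists a => //; apply: compl_pair; rewrite -pa setCK.
by exists [set~ a]; rewrite ?inE ?cardsC1 ?card_ord // (compl_pair _ a).
Qed.

(** Identifies the vertices of [T^r] with the entries of an [r.+1]-tuple whose triangle sits at
    prescribed positions: [l] lists these three first, then the remaining ones. *)
Lemma Tgraph_positions (r a b c : nat) : (2 <= r)%N -> uniq [:: a; b; c] ->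
  all (fun i => i < r.+1)%N [:: a; b; c] ->
  exists pos : 'I_3 + 'I_(r - 2) -> nat,
    [/\ injective pos, forall x, (pos x < r.+1)%N &
        [seq pos (inl i) | i <- enum 'I_3] = [:: a; b; c]].
Proof.
move=> r2 uabc /= /and4P[ar br cr _].
pose l := [:: a; b; c] ++ [seq i <- iota 0 r.+1 | i \notin [:: a; b; c]].
have ul : uniq l.
  rewrite cat_uniq uabc filter_uniq ?iota_uniq // andbT.
  by apply/hasPn => i; rewrite mem_filter => /andP[].
have li i : (i \in l) = (i < r.+1)%N.
  rewrite /l mem_cat mem_filter mem_iota add0n; case: (boolP (i \in _)) => //=.
  by rewrite !inE => /or3P[]/eqP->.
have sl : size l = r.+1.
  rewrite -(size_iota 0 r.+1); apply: perm_size; apply: uniq_perm; rewrite ?iota_uniq //.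
  by move=> i; rewrite li mem_iota.
pose idx (x : 'I_3 + 'I_(r - 2)) : nat := match x with inl i => i | inr y => (3 + y)%N end.
have idx_lt x : (idx x < size l)%N.
  by rewrite sl; case: x => [[i hi]|[y hy]] /=; lia.
exists (fun x => nth 0 l (idx x)); split.
- move=> x y /eqP; rewrite nth_uniq // => /eqP.
  case: x y => [x|x] [y|y] /= h.
  + by congr inl; apply/val_inj.
  + by have := ltn_ord x; rewrite h; lia.
  + by have := ltn_ord y; rewrite -h; lia.
  + by congr inr; apply/val_inj => /=; move: h; lia.
- by move=> x; rewrite -li mem_nth.
- by rewrite 3!enum_ordSl enum_ord0.
Qed.

Section TriangleTuples.
Variables (r : nat) (V : finType) (H : {set {set V}}) (x0 : V).
Hypotheses (r0 : (0 < r)%N) (uH : uniform r H).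

(* A copy of [T^r] with triangle vertices at positions [0], [i.+1], [j.+1]. *)
Definition triangle_tuple (i j : nat) (s : seq V) : bool :=
  uniq s && all (fun l => [set x in s] :\ nth x0 s l \in H) [:: 0; i.+1; j.+1].

(* Double counting of the pairs [(i, w)] with [w] in the link of [v] minus its
   [i]-th vertex: a vertex in at most one link contributes at most 1. *)
Lemma card_triangle_tuple k (v : seq V) :
  codegree_lower_bound r H k -> size v = r -> ordered_edge H v ->
  (r * k <= #|V| + r * #|[set w | [exists p : 'I_r * 'I_r,
      (p.1 != p.2) && triangle_tuple p.1 p.2 (w :: v)]]|)%N.
Proof.
move=> Hk sv /andP[uv vH]; set B := [set w | _].
pose e := [set x in v]; pose lk (i : 'I_r) := link H (e :\ nth x0 v i).
have nv (i : 'I_r) : nth x0 v i \in v by rewrite mem_nth // sv.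
have klk i : (k <= #|lk i|)%N.
  apply: (link_lower_bound r0 uH Hk _ vH); rewrite ?subsetDl //.
  have := cardsD1 (nth x0 v i) e.
  by rewrite (card_edge uH vH) inE nv => /(congr1 predn) ->.
apply: (@leq_trans (\sum_(i < r) #|lk i|))%N.
  rewrite -[r in (r * k)%N]card_ord -sum_nat_const; exact: leq_sum.
rewrite (eq_bigr (fun i => \sum_w (w \in lk i))%N); last first.
  by move=> i _; rewrite -sum1_card big_mkcond; apply: eq_bigr => w _; case: (w \in lk i).
rewrite exchange_big /=.
have -> : (#|V| + r * #|B| = \sum_w (1 + r * (w \in B)))%N.
  rewrite big_split /= sum1_card -big_distrr /=; congr (_ + r * _)%N.
  by rewrite -sum1_card big_mkcond; apply: eq_bigr => w _; case: (w \in B).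
apply: leq_sum => w _; have [wB|wB] := boolP (w \in B).
  rewrite muln1 (leq_trans _ (leq_addl _ _)) //.
  rewrite -[leqRHS]card_ord -sum1_card; apply: leq_sum => i _; exact: leq_b1.
rewrite muln0 addn0.
have -> : (\sum_(i < r) (w \in lk i) = #|[set i | w \in lk i]|)%N.
  by rewrite -sum1_card [RHS]big_mkcond; apply: eq_bigr => i _; rewrite inE; case: (w \in lk i).
apply/card_le1_eqP => i j; rewrite !inE => /andP[wi wiH] /andP[wj wjH].
(* If [w] lies in two links, then [w :: v] is a copy of [T^r]: deleting [w] leaves the edge [e], and
   deleting the [i]-th or [j]-th vertex of [v] leaves the edges given by the links. *)
apply: contraNeq wB => ij; rewrite inE; apply/existsP; exists (j, i); rewrite ij /=.
(* A vertex of [v] can only be in the link at its own position. *)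
have wv : w \notin v.
  apply/negP => wv; move: wi wj; rewrite wv !andbT !negbK => /eqP-> .
  by rewrite nth_uniq ?sv // => /eqP/val_inj/eqP; rewrite eq_sym (negbTE ij).
have wS (l : 'I_r) : [set x in w :: v] :\ nth x0 v l = w |: (e :\ nth x0 v l).
  apply/setP => x; rewrite !inE; have [->|//] := eqVneq x w; rewrite orTb andbT.
  by apply: contraNneq wv => ->.
rewrite /triangle_tuple /= wv uv /= !wS wiH wjH !andbT.
rewrite (_ : _ :\ w = e) //; apply/setP => x; rewrite !inE.
by have [->|//] := eqVneq x w; rewrite (negbTE wv).
Qed.

(** Each ordered edge has at least [d] completions to a triangle tuple for some pair of positions;
    pigeonhole over the pairs fixes one pair. *)
Lemma tsum_triangle_tuple (R : realType) k (d : R) :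
  (0 < k)%N -> H != set0 -> codegree_lower_bound r H k -> #|V|%:R + r%:R * d <= r%:R * k%:R ->
  0 < d ->
  exists2 p : 'I_r * 'I_r, p.1 != p.2 &
    d * k%:R ^+ r / (r ^ 2)%:R <= tsum r.+1 (fun s => (triangle_tuple p.1 p.2 s)%:R).
Proof.
move=> k0 H0 Hk hd d0; set D := d * _.
have rp : (0 : R) < r%:R by rewrite ltr0n.
pose good s := [exists p : 'I_r * 'I_r, (p.1 != p.2) && triangle_tuple p.1 p.2 s].
have D1 : D <= tsum r.+1 (fun s => (good s)%:R).
  rewrite /= -(tsum_sum r predT); apply: (@le_trans _ _ (d * tsum r (fun s => (ordered_edge H s)%:R))).
    by rewrite ler_wpM2l ?(ltW d0) // tsum_ordered_edge.
  rewrite -tsumZ; apply: ler_tsum => v sv.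
  have [ve|] := boolP (ordered_edge H v); last by rewrite mulr0 => _; apply: sumr_ge0.
  have := card_triangle_tuple Hk sv ve; rewrite -(ler_nat R) natrD !natrM => h.
  have := le_trans hd h; rewrite lerD2l ler_pM2l // mulr1 => /le_trans; apply.
  rewrite -natr_sum ler_nat -sum1_card big_mkcond; apply: leq_sum => w _.
  by rewrite inE -/(good _); case: (good _).
apply: contrapT => hp.
pose P (p : 'I_r * 'I_r) := p.1 != p.2.
have D2 : D <= \sum_(p | P p) tsum r.+1 (fun s => (triangle_tuple p.1 p.2 s)%:R).
  rewrite -tsum_sum; apply: le_trans D1 _; apply: ler_tsum => s _.
  rewrite -natr_sum ler_nat; have [/existsP[p /andP[pP tp]]|//] := boolP (good s).
  by rewrite (bigD1 p) //= tp.
have lt p : P p -> tsum r.+1 (fun s => (triangle_tuple p.1 p.2 s)%:R) < D / (r ^ 2)%:R.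
  by move=> Pp; rewrite ltNge; apply/negP => h; apply: hp; exists p.
have D3 : \sum_(p | P p) tsum r.+1 (fun s => (triangle_tuple p.1 p.2 s)%:R) <= \sum_(p | P p) D / (r ^ 2)%:R.
  by apply: ler_sum => p /lt/ltW.
have D0 : 0 < D by rewrite mulr_gt0 ?exprn_gt0 ?ltr0n.
(* Strict because diagonal pairs are excluded; this strictness is what contradicts [D2] and [D3]. *)
have cP : (#|P| < r ^ 2)%N.
  rewrite (_ : r ^ 2 = #|{: 'I_r * 'I_r}|)%N; last by rewrite card_prod card_ord -mulnn.
  rewrite -(cardC P) -[ltnLHS]addn0 ltn_add2l; apply/card_gt0P.
  by exists (Ordinal r0, Ordinal r0); rewrite inE; apply/negP; rewrite unfold_in /P eqxx.
have r2 : (0 : R) < (r ^ 2)%:R by rewrite ltr0n expn_gt0 r0.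
move: (le_trans D2 D3); rewrite sumr_const -[leRHS]mulr_natl mulrCA ler_pMr //.
by rewrite ler_pdivlMr // mul1r ler_nat leqNgt cP.
Qed.

End TriangleTuples.

Lemma codegree_free_Tgraph (R : realType) (r t : nat) (G : r_graph r) (eps : R) :
  (2 <= r)%N -> contained_in G (blowup r (Tgraph r) t) -> 0 < eps ->
  exists N, forall (V : finType) (H : {set {set V}}), (N <= #|V|)%N ->
    uniform r H -> ~ contained_in G H ->
    (min_pos_codegree r H)%:R <= (1 / r%:R + eps) * #|V|%:R.
Proof.
move=> r2 [f _ fP] eps0; have r0 : (0 < r)%N by apply: ltnW.
have rp : (0 : R) < r%:R by rewrite ltr0n.
pose c x := (f x).1.
have cP e : e \in edges G -> exists a, c @: e = ~: [set inl a].
  move=> eG; have := fP e eG; rewrite inE => /andP[_].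
  rewrite (_ : [set x.1 | x in f @: e] = c @: e); last first.
    by rewrite -imset_comp.
  by rewrite TgraphE => /imsetP[a _ ->]; exists a.
(* The projection of [e] to [T^r] is an edge, hence still has [r] vertices. *)
have cI e : e \in edges G -> {in e &, injective c}.
  move=> eG; apply/imset_injP; have := card_edge (edges_uniform G) eG => ->.
  have := fP e eG; rewrite inE => /andP[_].
  rewrite (_ : [set x.1 | x in f @: e] = c @: e); last by rewrite -imset_comp.
  by move/(card_edge (uniform_Tgraph r2)) ->.
(* At least [(n / r) ^ r] ordered edges, each with [eps * n] completions, shared among at most
   [r ^ 2] pairs of positions. *)
pose C := eps * (1 / r%:R) ^+ r / (r ^ 2)%:R.
have C0 : 0 < C by rewrite !(divr_gt0, mulr_gt0, exprn_gt0) // ltr0n expn_gt0 r0.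
have [N HN] := box_of_density r.+1 (nb_vertices G).+1 C0.
exists (maxn 1 N) => V H; rewrite geq_max => /andP[n0 nN] uH GH.
have [x0 _] := card_gt0P n0; rewrite -(ltr0n R) in n0.
rewrite leNgt; apply/negP => hk; apply: GH; set k := min_pos_codegree r H in hk.
have k0 : (0 : R) < k%:R by apply: lt_trans hk; rewrite mulr_gt0 ?addr_gt0 ?divr_gt0.
have H0 : H != set0.
  by apply/eqP => H0; move: k0; rewrite /k H0 /min_pos_codegree eqxx ltxx.
have Hk : codegree_lower_bound r H k by rewrite -min_pos_codegreeP.
rewrite ltr0n in k0.
have [||[i j] /= ij dens] := tsum_triangle_tuple x0 r0 uH (d := eps * #|V|%:R) k0 H0 Hk.
- move/ltW: hk; rewrite -(ler_pM2l rp) => /(le_trans _); apply.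
  by rewrite le_eqVlt; apply/orP; left; apply/eqP; field; rewrite gt_eqF.
- by rewrite mulr_gt0.
have [|g [gI gP]] := HN V (triangle_tuple H x0 i j) nN.
  apply: le_trans dens; rewrite /C [leLHS]mulrAC.
  rewrite ler_pM2r ?invr_gt0 ?ltr0n ?expn_gt0 ?r0 //.
  rewrite exprS mulrACA -exprMn ler_pM2l ?mulr_gt0 //.
  apply: lerXn2r; rewrite ?nnegrE // ?mulr_ge0 ?divr_ge0 ?ltW //.
  move: hk; rewrite mulrDl => h; apply: lt_trans h; rewrite ltrDl mulr_gt0 //.
have [||pos [posI pos_lt posE]] := @Tgraph_positions r 0 i.+1 j.+1 r2.
  by rewrite /= inE eqSS andbT ij.
  by rewrite /= !ltnS !ltn_ord.
have posl a : pos (inl a) \in [:: 0; i.+1; j.+1]%N.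
  by rewrite -posE; apply/mapP; exists a; rewrite ?mem_enum.
apply: (@box_contained _ _ _ _ r.+1 (pos \o c) (triangle_tuple H x0 i j) x0 g) => //.
- by move=> x; exact: pos_lt.
- by move=> e eG x y xe ye /posI; exact: (cI e eG).
- by move=> s _ /andP[].
- move=> s e ss /andP[us /allP sH] eG.
  have [a ca] := cP e eG.
  (* [e] projects onto the edge omitting [inl a], so it occupies every entry of [s] except the one
     at the position of [inl a]. *)
  suff -> : [set nth x0 s ((pos \o c) x) | x in e] = [set x in s] :\ nth x0 s (pos (inl a)).
    exact: sH.
  apply/eqP; rewrite eqEcard; apply/andP; split.
    apply/fintype.subsetP => _ /imsetP[x xe ->] /=; rewrite !inE mem_nth ?ss // andbT.
    rewrite nth_uniq ?ss //; apply/eqP => /posI cx.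
    by have := imset_f c xe; rewrite ca cx !inE eqxx.
  rewrite card_in_imset => [|x y xe ye /eqP]; last first.
    by rewrite nth_uniq ?ss //= => /eqP/posI; exact: (cI e eG).
  rewrite (card_edge (edges_uniform G) eG).
  have := cardsD1 (nth x0 s (pos (inl a))) [set x in s].
  rewrite inE mem_nth ?ss // cardsE (card_uniqP us) ss add1n => -[<-].
  exact: leqnn.
- by rewrite card_ord.
- by move=> a ha; apply: gP => l /ha; rewrite card_ord.
Qed.

(** * Constructions *)

Section Pullback.
Variables (r : nat) (I V : finType) (P : {set {set I}}) (q : V -> I).
Hypotheses (r0 : (0 < r)%N) (uP : uniform r P).

(** A blow-up of [P] whose classes are the fibres of [q], hence of arbitrary sizes, unlike in
    [blowup]. *)
Definition pullback : {set {set V}} :=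
  [set e : {set V} | (#|e| == r) && (q @: e \in P)].

Lemma uniform_pullback : uniform r pullback.
Proof. by apply/forall_inP => e; rewrite inE => /andP[]. Qed.

Lemma pullback_injective e : e \in pullback -> {in e &, injective q}.
Proof.
rewrite inE => /andP[/eqP ce qe]; apply/imset_injP.
by rewrite (card_edge uP qe) ce.
Qed.

Lemma pullback_codegree k :
  (forall S e : {set I}, e \in P -> S \subset e -> #|S| = r.-1 -> (k <= #|q @^-1: link P S|)%N) ->
  codegree_lower_bound r pullback k.
Proof.
move=> h; apply: (link_lower_boundP r0 uniform_pullback) => S e cS eH Se.
have qS : #|q @: S| = r.-1.
  rewrite card_in_imset // => x y xS yS.
  by apply: (pullback_injective eH); apply: (fintype.subsetP Se).
have qe : q @: e \in P by move: eH; rewrite inE => /andP[].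
apply: leq_trans (h _ _ qe (imsetS q Se) qS) _; apply: subset_leq_card.
apply/fintype.subsetP => v; rewrite !inE => /andP[qv qvP].
have vS : v \notin S by apply: contra qv; exact: imset_f.
by rewrite vS imsetU1 qvP cardsU1 vS cS add1n prednK // eqxx.
Qed.

Lemma pullback_neq0 : (forall i, exists v, q v = i) -> P != set0 -> pullback != set0.
Proof.
move=> sq /set0Pn[p pP]; have [g gK] := choice sq.
apply/set0Pn; exists (g @: p); rewrite inE -imset_comp.
rewrite card_imset ?(card_edge uP pP) ?eqxx /=; last exact: can_inj gK.
by rewrite (_ : _ @: p = p) // -[RHS]imset_id; apply: eq_imset => x; exact: gK.
Qed.

(** No class has more than [#|V|] vertices, so an uneven blow-up embeds in the even one of that
    size, copies being labelled by [enum_rank]. *)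
Lemma pullback_blowup (U : finType) (G : {set {set U}}) :
  contained_in G pullback -> contained_in G (blowup r P #|V|).
Proof.
case=> f fI fP; exists (fun x => (q (f x), enum_rank (f x))).
  by move=> x y [_ /enum_rank_inj/fI].
move=> e eG; have := fP e eG; rewrite !inE => /andP[/eqP <-].
rewrite !card_imset // => [|x y [_ /enum_rank_inj/fI]//].
by rewrite eqxx -!imset_comp.
Qed.

End Pullback.

Lemma pullback_partite (r : nat) (U V : finType) (q : V -> 'I_r) (G : {set {set U}}) :
  contained_in G (pullback r [set [set: 'I_r]] q) -> partite r G.
Proof.
case=> f fI fP; exists (q \o f) => e /fP fe i; apply/card_le1_eqP => x y.
rewrite !inE => /andP[xe /eqP qx] /andP[ye /eqP qy]; apply/fI.
have uT : uniform r [set [set: 'I_r]].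
  by apply/forall_inP => p; rewrite inE => /eqP->; rewrite cardsT card_ord.
by apply: (pullback_injective uT fe); rewrite ?imset_f //; move: qx qy => /= -> ->.
Qed.

(** Each complete block of [size l] consecutive integers runs through [l] once; the incomplete last
    block is dropped. *)
Lemma count_cyclic (I : Type) (x0 : I) (l : seq I) (A : pred I) (n : nat) :
  (n %/ size l * count A l <= #|[set x : 'I_n | A (nth x0 l (x %% size l))]|)%N.
Proof.
set d := size l.
have block m : (\sum_(0 <= x < m * d) A (nth x0 l (x %% d)) = m * count A l)%N.
  elim: m => [|m IH]; first by rewrite mul0n big_geq.
  rewrite (@big_cat_nat _ _ _ (m * d)) ?leq_mul //= IH [RHS]mulSnr; congr (_ + _)%N.
  rewrite -[X in index_iota X _]add0n big_addn mulSnr addKn -sum1_count [RHS]big_mkcond.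
  rewrite [RHS](big_nth x0); apply: eq_big_nat => i /andP[_ id].
  by rewrite addnC modnMDl modn_small //; case: (A _).
rewrite -block -sum1_card [leqRHS]big_mkcond /=.
rewrite [leqRHS](eq_bigr (fun x : 'I_n => A (nth x0 l (x %% d)) : nat)); last first.
  by move=> x _; rewrite inE; case: (A _).
rewrite -(big_mkord predT (fun x => A (nth x0 l (x %% d)) : nat)).
by rewrite [leqRHS](@big_cat_nat _ _ _ (n %/ d * d)) ?leq_divM //= leq_addr.
Qed.

Lemma coex_ge (r : nat) (F : set (r_graph r)) (n k : nat) (H : {set {set 'I_n}}) :
  uniform r H -> family_free F H -> H != set0 -> codegree_lower_bound r H k ->
  (k <= coex F n)%N.
Proof.
move=> uH fH H0 Hk; rewrite -(min_pos_codegreeP _ H0 uH) in Hk.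
apply: leq_trans Hk _; apply: (leq_bigmax_cond (P := fun H => uniform r H && `[< family_free F H >])).
by rewrite uH; apply/asboolP.
Qed.

Lemma coex_le (r : nat) (F : set (r_graph r)) (n k : nat) :
  (forall H : {set {set 'I_n}}, uniform r H -> family_free F H -> (min_pos_codegree r H <= k)%N) ->
  (coex F n <= k)%N.
Proof.
by move=> h; apply/bigmax_leqP => H /andP[uH /asboolP]; exact: h.
Qed.

Lemma coex_le_n (r : nat) (F : set (r_graph r)) (n : nat) : (0 < r)%N -> (coex F n <= n)%N.
Proof.
move=> r0; apply: coex_le => H uH _; rewrite -[leqRHS]card_ord.
exact: min_pos_codegree_le.
Qed.

(* The multiplicity of [i] in [l] is the weight of [i] in the blow-up of [P]. *)
Lemma coex_ge_cyclic (r n w : nat) (F : set (r_graph r)) (I : finType)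
    (P : {set {set I}}) (i0 : I) (l : seq I) : (0 < r)%N ->
  uniform r P -> P != set0 -> (forall i, i \in l) -> (0 < w)%N ->
  (forall S e : {set I}, e \in P -> S \subset e -> #|S| = r.-1 -> (w <= count (mem (link P S)) l)%N) ->
  family_free F (pullback r P (fun x : 'I_n => nth i0 l (x %% size l))) ->
  (n %/ size l * w <= coex F n)%N.
Proof.
move=> r0 uP P0 il w0 hw fF; have [->//|] := posnP (n %/ size l).
have sl : (0 < size l)%N by rewrite -has_predT; apply/hasP; exists i0.
rewrite divn_gt0 // => ln.
apply: (coex_ge (uniform_pullback _ _ _) fF).
  apply: pullback_neq0 => // i; have hi : (index i l < size l)%N by rewrite index_mem.
  exists (Ordinal (leq_trans hi ln)) => /=.
  by rewrite modn_small // nth_index.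
apply: pullback_codegree => // S e eP Se cS.
apply: leq_trans (leq_mul (leqnn _) (hw S e eP Se cS)) _.
apply: leq_trans (count_cyclic i0 _ _ _) _; apply: subset_leq_card.
by apply/fintype.subsetP => x; rewrite !inE.
Qed.

(** Blow-up of a single edge with all weights 1: the link of an [(r-1)]-subset is the one missing
    vertex. *)
Lemma coex_ge_partite (r : nat) (F : set (r_graph r)) (n : nat) : (0 < r)%N ->
  (forall G : r_graph r, F G -> ~ partite r G) -> (n %/ r <= coex F n)%N.
Proof.
move=> r0 hF; have sr : size (enum 'I_r) = r by rewrite -cardE card_ord.
have uT : uniform r [set [set: 'I_r]].
  by apply/forall_inP => p; rewrite inE => /eqP->; rewrite cardsT card_ord.
have := @coex_ge_cyclic r n 1 F _ [set [set: 'I_r]] (Ordinal r0) (enum 'I_r) r0 uT.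
rewrite sr muln1; apply=> //.
- by apply/set0Pn; exists setT; rewrite inE.
- by move=> i; rewrite mem_enum.
- move=> S _ /set1P-> _ cS.
  have : #|~: S| == 1%N.
    by rewrite cardsCs setCK cS card_ord; case: (r) r0 => // m _; rewrite subSnn.
  case/cards1P => i Si; rewrite -has_count; apply/hasP; exists i; rewrite ?mem_enum //.
  have iS : i \notin S by rewrite -in_setC Si set11.
  by rewrite !inE iS /=; apply/eqP/setP => x; rewrite -Si !inE orNb.
- by move=> G FG /pullback_partite; exact: hF.
Qed.

Lemma coex_ge_Tgraph (r : nat) (F : set (r_graph r)) (n : nat) : (2 <= r)%N ->
  (forall G : r_graph r, F G -> forall t, ~ contained_in G (blowup r (Tgraph r) t)) ->
  (n %/ (2 * r).-1 * 2 <= coex F n)%N.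
Proof.
move=> r2 hF; have r0 : (0 < r)%N by apply: ltnW.
(* Triangle vertices have weight 1 and common vertices weight 2, for a total of
   [3 + 2 * (r - 2) = 2 * r - 1]. *)
pose l : seq ('I_3 + 'I_(r - 2)) := enum {: 'I_3 + 'I_(r - 2)} ++ [seq inr y | y <- enum 'I_(r - 2)].
have sl : size l = (2 * r).-1.
  by rewrite /l size_cat -cardE [X in (_ + X)%N]size_map -cardE card_sum !card_ord; lia.
have := @coex_ge_cyclic r n 2 F _ (Tgraph r) (inl ord0) l r0 (uniform_Tgraph r2).
rewrite sl; apply=> //.
- by apply/set0Pn; exists (~: [set inl ord0]); rewrite TgraphE; apply/imsetP; exists ord0.
- by move=> i; rewrite mem_cat mem_enum.
- move=> S e; rewrite TgraphE => /imsetP[a _ ->] Se cS.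
  have ce : #|~: [set inl a : 'I_3 + 'I_(r - 2)]| = r.
    by rewrite cardsC1 card_sum !card_ord; lia.
  have : #|~: [set inl a] :\: S| == 1%N.
    by rewrite cardsD (setIidPr Se) ce cS; case: (r) r0 => // m _; rewrite subSnn.
  case/cards1P => z zE.
  have SE : S = ~: [set inl a; z].
    apply/setP => x; move/setP/(_ x): zE; move/fintype.subsetP/(_ x): Se; rewrite !inE.
    by case: (x \in S); case: (x == z); case: (x == inl a) => //= -> //.
  have za : z != inl a by have := set11 z; rewrite -zE !inE => /andP[].
  have zlink : z \in link (Tgraph r) S.
    rewrite inE SE !inE eqxx orbT TgraphE; apply/imsetP; exists a => //.
    by apply/setP => x; rewrite !inE; have [->|] := eqVneq x z; rewrite ?za ?orbF.
  have cE : count (mem (link (Tgraph r) S)) (enum {: 'I_3 + 'I_(r - 2)}) = #|link (Tgraph r) S|.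
    by rewrite -sum1_count big_enum_cond -sum1_card; apply: eq_bigl => x; rewrite inE.
  rewrite TgraphE in zlink cE; rewrite count_cat cE.
  (* The link of [S] has weight at least 2 either way: if [z] is a triangle vertex it also contains
     [inl a], and a common vertex [z] counts twice. *)
  case: z za zE SE zlink => [b|y] za zE SE zlink.
    apply: leq_trans (leq_addr _ _).
    have alink : inl a \in link [set ~: [set inl a] | a : 'I_3] S.
      rewrite inE SE !inE eqxx /=; apply/imsetP; exists b => //.
      by apply/setP => x; rewrite !inE; have [->|] := eqVneq x (inl a); rewrite //= eq_sym za.
    apply/card_gt1P; exists (inl a), (inl b); split => //.
    by rewrite eq_sym.
  rewrite -[2%N]/(1 + 1)%N leq_add //; first by apply/card_gt0P; exists (inr y).
  by rewrite -has_count; apply/hasP; exists (inr y); rewrite // map_f ?mem_enum.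
- by move=> G FG /pullback_blowup; rewrite card_ord; exact: hF.
Qed.

(** * Sampling *)

Section Sampling.
Variables (R : realType) (J V : finType).
Implicit Types (S : {set J}) (phi psi : {ffun J -> V}).

(* Resampling [phi] outside [S]: averaging over [psi] conditions on [S]. *)
Definition mix S phi psi : {ffun J -> V} :=
  [ffun j => if j \in S then phi j else psi j].

(** Exchanging [phi] and [psi] outside [S] is an involution on pairs, so the mixture of two
    independent uniform samples is again uniform. *)
Lemma sum_mix S (g : {ffun J -> V} -> R) :
  \sum_phi \sum_psi g (mix S phi psi) = #|V|%:R ^+ #|J| * \sum_phi g phi.
Proof.
pose h (u : {ffun J -> V} * {ffun J -> V}) := (mix S u.1 u.2, mix S u.2 u.1).
have hK : involutive h.
  by case=> phi psi; congr (_, _); apply/ffunP => j; rewrite !ffunE; case: (_ \in S).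
rewrite pair_bigA /= (reindex_inj (inv_inj hK)) /=.
rewrite (eq_bigr (fun u : {ffun J -> V} * {ffun J -> V} => g u.1)); last first.
  by move=> u _; rewrite -[u in RHS]hK.
rewrite -(pair_bigA _ (fun phi _ => g phi)) /= mulr_sumr; apply: eq_bigr => phi _.
by rewrite sumr_const card_ffun -natrX mulr_natl.
Qed.

(* Chernoff's bound conditionally on the coordinates in [S], with [lam] standing
   for the exponential of the (negative) parameter; the case [lam = 0], [K = 0]
   bounds the probability that no coordinate outside [S] hits [A]. *)
Lemma tail_bound S (A : {ffun J -> V} -> {set V}) (K : nat) (p lam : R) :
  (0 < #|V|)%N ->
  (forall phi psi, {in S, phi =1 psi} -> A phi = A psi) ->
  0 <= lam <= 1 -> p <= 1 ->
  #|[set phi : {ffun J -> V} | (p * #|V|%:R <= #|A phi|%:R) &&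
      (#|[set j in ~: S | phi j \in A phi]| <= K)%N]|%:R * lam ^+ K <=
  #|V|%:R ^+ #|J| * (1 - (1 - lam) * p) ^+ #|~: S|.
Proof.
move=> n0 AS /andP[lam0 lam1] p1; set B := [set phi | _]; set n : R := #|V|%:R.
have np : 0 < n by rewrite ltr0n.
(* Markov's inequality: [g] weighs each hit by [lam], so it is at least [lam ^ K] on the bad event
   [B]. *)
pose w (X : {set V}) v : R := if v \in X then lam else 1.
pose g phi : R := (p * n <= #|A phi|%:R)%R%:R * \prod_(j in ~: S) w (A phi) (phi j).
have w0 X v : 0 <= w X v by rewrite /w; case: ifP.
have prodE phi : \prod_(j in ~: S) w (A phi) (phi j) = lam ^+ #|[set j in ~: S | phi j \in A phi]|.
  rewrite -prodr_const [RHS](eq_bigl (fun j => (j \in ~: S) && (phi j \in A phi))); last first.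
    by move=> j; rewrite inE.
  by rewrite [RHS]big_mkcondr.
have BE : #|B|%:R * lam ^+ K <= \sum_phi g phi.
  rewrite -sum1_card natr_sum mulr_suml big_mkcond; apply: ler_sum => phi _.
  rewrite inE; case: ifP => [/andP[pA cK]|_].
    by rewrite /g pA !mul1r prodE ler_wiXn2l.
  by rewrite mulr_ge0 ?prodr_ge0.
rewrite -/n; apply: le_trans BE _.
have nJ : 0 < n ^+ #|J| by exact: exprn_gt0.
rewrite -(ler_pM2l nJ) -(sum_mix S).
apply: (@le_trans _ _ (\sum_(phi : {ffun J -> V}) n ^+ #|J| * (1 - (1 - lam) * p) ^+ #|~: S|)); last first.
  by rewrite sumr_const card_ffun -natrX [leRHS]mulr_natl.
apply: ler_sum => phi _.
have rho0 : 0 <= 1 - (1 - lam) * p.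
  have h : (1 - lam) * p <= (1 - lam) * 1 by rewrite ler_wpM2l // subr_ge0.
  by lra.
(* With the coordinates in [S] frozen the target set is constant, so the sum over [psi] factors over
   coordinates. *)
have gE psi : g (mix S phi psi) = (p * n <= #|A phi|%:R)%R%:R *
    \prod_j (if j \in S then 1 else w (A phi) (psi j)).
  rewrite /g (AS (mix S phi psi) phi) => [|j jS]; last by rewrite ffunE jS.
  congr (_ * _); rewrite big_mkcond; apply: eq_bigr => j _.
  by rewrite ffunE inE; case: (j \in S).
rewrite (eq_bigr _ (fun psi _ => gE psi)) -mulr_sumr.
rewrite -(bigA_distr_bigA (fun j v => if j \in S then 1 else w (A phi) v)).
case: (boolP (p * n <= _)) => [pA|_]; last first.
  by rewrite mul0r mulr_ge0 ?exprn_ge0 // ltW.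
have nE : n ^+ #|J| = \prod_(j : J) n by rewrite prodr_const.
have rhoE x : x ^+ #|~: S| = \prod_j (if j \in ~: S then x else 1) :> R.
  by rewrite -big_mkcond prodr_const.
rewrite mul1r nE rhoE -big_split /=.
apply: ler_prod => j _; apply/andP; split.
  by apply: sumr_ge0 => v _; case: ifP.
rewrite inE; case: (j \in S) => /=; first by rewrite sumr_const mulr1.
have -> : \sum_v w (A phi) v = n - (1 - lam) * #|A phi|%:R.
  rewrite (eq_bigr (fun v => 1 - (1 - lam) * (v \in A phi)%:R)); last first.
    by move=> v _; rewrite /w; case: (v \in _); rewrite ?mulr1 ?mulr0 ?subr0 // opprB addrC subrK.
  rewrite sumrB sumr_const -mulr_sumr; congr (_ - _ * _).
  by rewrite -natr_sum -sum1_card [in RHS]big_mkcond; congr _%:R; apply: eq_bigr => v _; case: (v \in _).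
have h : (1 - lam) * (p * n) <= (1 - lam) * #|A phi|%:R by rewrite ler_wpM2l // subr_ge0.
by lra.
Qed.

End Sampling.


Lemma bin_le_exp (m k : nat) : ('C(m, k) <= m ^ k)%N.
Proof.
elim: m k => [|m IH] [|k]; rewrite ?bin0 ?expn0 // binS.
have mk : (m ^ k <= m.+1 ^ k)%N by case: k => // k; rewrite leq_exp2r.
by rewrite expnS mulSn addnC leq_add ?(leq_trans (IH _)) // expnS leq_mul.
Qed.

(** * Random samples containing a fixed edge *)

Section Sample.
Variables (R : realType) (r M : nat) (V : finType) (H : {set {set V}}).
Hypotheses (r0 : (0 < r)%N) (uH : uniform r H).
Variable iota : 'I_r -> V.
Hypotheses (iotaI : injective iota) (iotaH : [set iota a | a : 'I_r] \in H).
Implicit Types (psi : {ffun 'I_M -> V}) (S : {set 'I_(r + M)}).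

(** The first [r] vertices are a fixed edge of [H], which guarantees that the sampled graph is not
    edgeless; only the other [M] are random. *)
Definition sample psi (x : 'I_(r + M)) : V :=
  match split x with inl a => iota a | inr b => psi b end.

Lemma sample_lshift psi a : sample psi (lshift M a) = iota a.
Proof. by rewrite /sample (unsplitK (inl a)). Qed.

Lemma sample_rshift psi b : sample psi (rshift r b) = psi b.
Proof. by rewrite /sample (unsplitK (inr b)). Qed.

Definition sampled_graph psi : {set {set 'I_(r + M)}} :=
  [set e : {set 'I_(r + M)} | sample psi @: e \in H].

Definition sample_set S : {set 'I_M} := [set b | rshift r b \in S].

Definition hit psi (b : 'I_M) : {set V} :=
  [set iota a | a : 'I_r] :|: psi @: [set~ b].

Lemma sample_injective psi :
  (forall b, psi b \notin hit psi b) -> injective (sample psi).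
Proof.
move=> hp x y; rewrite -(splitK x) -(splitK y).
case: (split x) (split y) => [a|b] [a'|b'] /=; rewrite ?sample_lshift ?sample_rshift.
- by move/iotaI->.
- by move=> h; have := hp b'; rewrite inE -h imset_f.
- by move=> h; have := hp b; rewrite inE h imset_f.
- move=> h; have [->//|bb'] := eqVneq b b'; have := hp b.
  by rewrite inE h imset_f ?orbT // !inE eq_sym.
Qed.

(** A facet [S] of a sampled edge maps to a facet of an edge of [H], so the large-link premise holds
    for it; for other [S] nothing is required. *)
Lemma sampled_graph_codegree psi (k K : nat) :
  injective (sample psi) ->
  codegree_lower_bound r H k ->
  (forall S, #|S| = r.-1 -> (k <= #|link H (sample psi @: S)|)%N ->
     (K < #|[set b in ~: sample_set S | psi b \in link H (sample psi @: S)]|)%N) ->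
  [/\ uniform r (sampled_graph psi), sampled_graph psi != set0,
      contained_in (sampled_graph psi) H &
      codegree_lower_bound r (sampled_graph psi) K.+1].
Proof.
move=> sI Hk hK.
have uS : uniform r (sampled_graph psi).
  apply/forall_inP => e; rewrite inE => /(card_edge uH).
  by rewrite card_imset // => ->.
split=> //.
- apply/set0Pn; exists [set lshift M a | a : 'I_r]; rewrite inE -imset_comp.
  by rewrite (eq_imset (g := iota)) // => a /=; rewrite sample_lshift.
- by exists (sample psi) => // e; rewrite inE.
- apply: (link_lower_boundP r0 uS) => S e cS; rewrite inE => eH Se.
  have kS : (k <= #|link H (sample psi @: S)|)%N.
    by apply: (link_lower_bound r0 uH Hk _ eH); rewrite ?card_imset ?imsetS.
  apply: leq_trans (hK S cS kS) _; rewrite -(card_imset _ (@rshift_inj r M)).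
  apply: subset_leq_card; apply/fintype.subsetP => _ /imsetP[b + ->].
  rewrite !inE => /andP[bS /andP[_ bH]].
  by rewrite bS imsetU1 sample_rshift.
Qed.

Lemma card_hit_bound b : (0 < M)%N ->
  #|[set psi : {ffun 'I_M -> V} | psi b \in hit psi b]|%:R * #|V|%:R <=
  #|V|%:R ^+ M * (r + M)%:R :> R.
Proof.
move=> M0; set n : R := #|V|%:R.
have n0 : (0 < #|V|)%N by apply/card_gt0P; exists (iota (Ordinal r0)).
have np : 0 < n by rewrite ltr0n.
pose A psi := ~: hit psi b; pose p : R := 1 - (r + M)%:R / n.
have Aeq psi psi' : {in ~: [set b], psi =1 psi'} -> A psi = A psi'.
  by move=> h; congr (~: (_ :|: _)); apply: eq_in_imset.
(* All coordinates but [b] are frozen, and [lam ^+ K] is [0 ^ 0 = 1]; the bound becomes [1 - p], the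
   proportion taken by the at most [r + M] vertices to avoid. *)
have := @tail_bound R _ V (~: [set b]) A 0 p 0 n0 Aeq.
rewrite lexx ler01 expr0 mulr1 setCK cards1 expr1 subr0 mul1r card_ord.
have -> : 1 - p = (r + M)%:R / n by rewrite /p opprB addrC subrK.
move=> /(_ isT) h; rewrite -ler_pdivlMr // -mulrA; apply: le_trans (h _); last first.
  by rewrite /p gerBl divr_ge0 // ltW.
rewrite ler_nat; apply: subset_leq_card; apply/fintype.subsetP => psi.
rewrite inE => bh; rewrite inE; apply/andP; split.
  rewrite mulrBl mul1r divfK ?gt_eqF // lerBlDr -natrD ler_nat.
  rewrite -(cardsC (hit psi b)) addnC leq_add2l.
  apply: leq_trans (leq_card_setU _ _) _; apply: leq_add.
    by rewrite card_imset // card_ord.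
  by apply: leq_trans (leq_imset_card _ _) _; rewrite -[leqRHS]card_ord max_card.
rewrite leqn0 cards_eq0; apply/eqP/setP => j; rewrite !inE.
by have [->|//] := eqVneq j b; rewrite -in_setU -/(hit psi b) bh.
Qed.

(** The link depends only on the random coordinates in [S], at most [r - 1] of them, so at least
    [M - r] coordinates remain free for [tail_bound]. *)
Lemma card_low_link_bound S (K : nat) (p lam : R) : 0 <= lam <= 1 -> p <= 1 -> 0 <= p ->
  #|S| = r.-1 ->
  #|[set psi : {ffun 'I_M -> V} | (p * #|V|%:R <= #|link H (sample psi @: S)|%:R) &&
      (#|[set b in ~: sample_set S | psi b \in link H (sample psi @: S)]| <= K)%N]|%:R * lam ^+ K <=
  #|V|%:R ^+ M * (1 - (1 - lam) * p) ^+ (M - r).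
Proof.
move=> lam01 p1 p0 cS.
have n0 : (0 < #|V|)%N by apply/card_gt0P; exists (iota (Ordinal r0)).
have Seq psi psi' : {in sample_set S, psi =1 psi'} ->
    link H (sample psi @: S) = link H (sample psi' @: S).
  move=> h; congr link; apply: eq_in_imset => x; rewrite -(splitK x).
  case: (split x) => [a|b] /= xS; rewrite ?sample_lshift ?sample_rshift //.
  by apply: h; rewrite inE.
apply: le_trans (tail_bound K n0 Seq lam01 p1) _; rewrite card_ord.
rewrite ler_wpM2l ?exprn_ge0 //; case/andP: lam01 => lam0 lam1.
have h : (1 - lam) * p <= (1 - lam) * 1 by rewrite ler_wpM2l // subr_ge0.
have h' : 0 <= (1 - lam) * p by rewrite mulr_ge0 // subr_ge0.
apply: ler_wiXn2l; [lra|lra|].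
have cSS : (#|sample_set S| <= r.-1)%N.
  rewrite -cS -(card_imset _ (@rshift_inj r M)); apply: subset_leq_card.
  by apply/fintype.subsetP => _ /imsetP[b + ->]; rewrite inE.
rewrite -[M in (M - r)%N]card_ord -(cardsC (sample_set S)) leq_subLR leq_add2r.
exact: leq_trans cSS (leq_pred r).
Qed.

(** Union bound: collisions ([B1]) cover less than half of all [psi]; low links ([B2]), over at most
    [(r + M) ^ r] sets [S], cover at most half. *)
Lemma exists_sample (k K : nat) (p lam : R) : (0 < M)%N ->
  codegree_lower_bound r H k -> p * #|V|%:R <= k%:R -> 0 <= p <= 1 -> 0 < lam <= 1 ->
  2 * M%:R * (r + M)%:R < #|V|%:R :> R ->
  2 * (r + M)%:R ^+ r * (1 - (1 - lam) * p) ^+ (M - r) <= lam ^+ K ->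
  exists H' : {set {set 'I_(r + M)}},
    [/\ uniform r H', H' != set0, contained_in H' H & codegree_lower_bound r H' K.+1].
Proof.
move=> M0 Hk pk /andP[p0 p1] /andP[lam0 lam1] hn hK; set n : R := #|V|%:R.
have np : 0 < n.
  by rewrite ltr0n; apply/card_gt0P; exists (iota (Ordinal r0)).
pose B1 b := [set psi : {ffun 'I_M -> V} | psi b \in hit psi b].
pose B2 S := [set psi : {ffun 'I_M -> V} | (p * n <= #|link H (sample psi @: S)|%:R) &&
      (#|[set b in ~: sample_set S | psi b \in link H (sample psi @: S)]| <= K)%N].
pose B := (\bigcup_b B1 b) :|: \bigcup_(S : {set 'I_(r + M)} | #|S| == r.-1) B2 S.
have cup (I : finType) (P : pred I) (F : I -> {set {ffun 'I_M -> V}}) :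
    (#|\bigcup_(i | P i) F i| <= \sum_(i | P i) #|F i|)%N.
  elim/big_rec2: _ => [|i m X _ Xm]; first by rewrite cards0.
  by apply: leq_trans (leq_card_setU _ _) _; rewrite leq_add2l.
have nM : 0 < n ^+ M by exact: exprn_gt0.
have c1 : (\sum_b #|B1 b|)%:R < n ^+ M / 2.
  rewrite -(ltr_pM2r np) natr_sum mulr_suml.
  apply: (@le_lt_trans _ _ (\sum_(b < M) n ^+ M * (r + M)%:R)).
    by apply: ler_sum => b _; exact: card_hit_bound.
  rewrite sumr_const card_ord -mulrnAr -mulrA ltr_pM2l // -[ltLHS]mulr_natl.
  by move: hn; rewrite -/n; lra.
have c2 : (\sum_(S : {set 'I_(r + M)} | #|S| == r.-1) #|B2 S|)%:R <= n ^+ M / 2.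
  have lamK : 0 < lam ^+ K by exact: exprn_gt0.
  rewrite -(ler_pM2r lamK) natr_sum mulr_suml.
  apply: (@le_trans _ _ (\sum_(S : {set 'I_(r + M)} | #|S| == r.-1) n ^+ M * (1 - (1 - lam) * p) ^+ (M - r))).
    by apply: ler_sum => S /eqP cS; apply: card_low_link_bound; rewrite // ltW.
  rewrite -mulr_sumr -mulrA ler_pM2l // sumr_const.
  rewrite (eq_card (B := [set S : {set 'I_(r + M)} | #|S| == r.-1])); last first.
    by move=> S; rewrite inE.
  rewrite card_draws card_ord -[leLHS]mulr_natl.
  rewrite -(ler_pM2l (ltr0Sn R 1)) [leRHS]mulrA divff // mul1r [leLHS]mulrA.
  apply: le_trans hK; rewrite ler_wpM2r //.
    apply: exprn_ge0; have h : (1 - lam) * p <= (1 - lam) * 1 by rewrite ler_wpM2l // subr_ge0.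
    by lra.
  rewrite ler_wpM2l // -natrX ler_nat; apply: leq_trans (bin_le_exp _ _) _.
  by rewrite leq_pexp2l ?leq_pred // addn_gt0 r0.
have cB : (#|B| < #|{ffun 'I_M -> V}|)%N.
  rewrite -(ltr_nat R) card_ffun card_ord natrX -/n.
  apply: (@le_lt_trans _ _ ((\sum_b #|B1 b|)%:R + (\sum_(S : {set 'I_(r + M)} | #|S| == r.-1) #|B2 S|)%:R)).
    rewrite -natrD ler_nat; apply: leq_trans (leq_card_setU _ _) _.
    by apply: leq_add; exact: cup.
  by rewrite [ltRHS]splitr ltr_leD.
have [psi psiB] : exists psi, psi \notin B.
  apply: contrapT => h; move: cB; rewrite ltnNge => /negP; apply.
  rewrite -cardsT; apply: subset_leq_card; apply/fintype.subsetP => psi _.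
  by apply/negPn/negP => hp; apply: h; exists psi.
move: psiB; rewrite inE negb_or => /andP[/bigcupP h1 /bigcupP h2].
exists (sampled_graph psi); apply: (@sampled_graph_codegree psi k K) => //.
  by apply: sample_injective => b; apply/negP => hb; apply: h1; exists b => //; rewrite inE.
move=> S cS kS; rewrite ltnNge; apply/negP => hS; apply: h2; exists S; first exact/eqP.
by rewrite inE hS andbT (le_trans pk) // ler_nat.
Qed.

End Sample.

(** * The limit density *)

Lemma sampling_rate (R : realType) (r : nat) (p q : R) : 0 <= q < p -> p <= 1 ->
  exists2 lam : R, 0 < lam <= 1 & exists M0, forall M, (M0 <= M)%N ->
    2 * (r + M)%:R ^+ r * (1 - (1 - lam) * p) ^+ (M - r) <=
    lam ^+ Num.truncn (q * (r + M)%:R).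
Proof.
move=> /andP[q0 qp] p1; have pp : 0 < p by apply: le_lt_trans qp.
have pq0 : 0 < p + q by rewrite ltr_wpDr.
(* Chosen so that the base is [1 - d], at most [exp(-d)], while [lam = 1 / (1 + s)] is at least
   [exp(-s)]. The gap between the exponents is then [c = d - s * q = d * s > 0] per vertex. *)
pose lam : R := (p + q) / (2 * p); pose d : R := (p - q) / 2; pose s : R := (p - q) / (p + q).
have d0 : 0 < d by rewrite divr_gt0 // subr_gt0.
have s0 : 0 < s by rewrite divr_gt0 // subr_gt0.
have lam0 : 0 < lam by rewrite divr_gt0 // mulr_gt0.
have lam1 : lam <= 1 by rewrite ler_pdivrMr ?mulr_gt0 // mul1r; lra.
have dE : 1 - (1 - lam) * p = 1 - d by rewrite /lam /d; field; rewrite gt_eqF.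
have lamE : lam = (1 + s)^-1.
  by rewrite /lam /s; field; rewrite !gt_eqF //; lra.
pose c := d - s * q.
have c0 : 0 < c.
  have -> : c = d * s.
    by rewrite /c /d /s; field; rewrite gt_eqF.
  exact: mulr_gt0.
exists lam; first by rewrite lam0 lam1.
(* Beyond [C], the term [(c * m) ^ (r + 1) / (r + 1)!] of the series of [exp(c * m)] already
   dominates [2 * m ^ r * exp(2 * r * d)]. *)
pose C : R := 2 * expR (d * (2 * r)%:R) * (r.+1)`!%:R / c ^+ r.+1.
have [N HN] := natr_unbounded C.
exists (maxn r N) => M; rewrite geq_max => /andP[rM NM]; rewrite dE.
set m : R := (r + M)%:R.
have m0 : 0 <= m by exact: ler0n.
have Cm : C <= m by rewrite ltW // HN // (leq_trans NM) ?leq_addl.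
have d1 : d <= 1 by rewrite /d; lra.
have h1 : (1 - d) ^+ (M - r) <= expR (- d * (m - (2 * r)%:R)).
  have -> : m - (2 * r)%:R = (M - r)%:R by rewrite /m natrD natrM natrB //; ring.
  rewrite expRM_natr lerXn2r ?nnegrE ?expR_ge0 ?subr_ge0 //.
  exact: expR_ge1Dx.
have h2 : expR (- s * (q * m)) <= lam ^+ Num.truncn (q * m).
  have qm : 0 <= q * m by exact: mulr_ge0.
  apply: (@le_trans _ _ (expR (- s) ^+ Num.truncn (q * m))).
    by rewrite -expRM_natr ler_expR !mulNr lerN2 ler_pM2l // truncn_le.
  rewrite lerXn2r ?nnegrE ?expR_ge0 ?(ltW lam0) // lamE expRN lef_pV2 ?posrE ?expR_gt0 ?addr_gt0 //.
  exact: expR_ge1Dx.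
apply: le_trans h2; have mr : 0 <= 2 * m ^+ r by rewrite mulr_ge0 ?exprn_ge0.
apply: le_trans (ler_wpM2l mr h1) _.
have -> : - d * (m - (2 * r)%:R) = - s * (q * m) + (d * (2 * r)%:R - c * m).
  by rewrite /c; ring.
rewrite expRD mulrCA -[leRHS]mulr1 ler_pM2l ?expR_gt0 // expRD expRN mulrA.
rewrite ler_pdivrMr ?expR_gt0 // mul1r.
have := expR_ge1Dxn r (mulr_ge0 (ltW c0) m0).
apply: le_trans; rewrite -[leLHS]add0r lerD //.
rewrite ler_pdivlMr ?ltr0n ?fact_gt0 //.
have cr : 0 < c ^+ r.+1 by exact: exprn_gt0.
move: Cm; rewrite /C ler_pdivrMr // => /(ler_wpM2l (exprn_ge0 r m0)).
rewrite exprMn [in leRHS]exprS => h.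
have -> : 2 * m ^+ r * expR (d * (2 * r)%:R) * (r.+1)`!%:R = m ^+ r * (2 * expR (d * (2 * r)%:R) * (r.+1)`!%:R) by ring.
by apply: le_trans h _; rewrite -exprS exprS [in leRHS]mulrC mulrA [m ^+ r * m]mulrC exprS.
Qed.

Lemma coex_le_real (R : realType) (r : nat) (F : set (r_graph r)) (n : nat) (x : R) : 0 <= x ->
  (forall H : {set {set 'I_n}}, uniform r H -> family_free F H -> (min_pos_codegree r H)%:R <= x) ->
  (coex F n)%:R <= x.
Proof.
move=> x0 h; rewrite -truncn_ge_nat //; apply: coex_le => H uH fH.
by rewrite truncn_ge_nat // h.
Qed.

(** Positivity rules out the default value 0 of an empty maximum. *)
Lemma coex_attained (r : nat) (F : set (r_graph r)) (n : nat) : (0 < coex F n)%N ->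
  exists H : {set {set 'I_n}},
    [/\ uniform r H, family_free F H & min_pos_codegree r H = coex F n].
Proof.
move=> c0; apply: contrapT => hn.
have : (coex F n <= (coex F n).-1)%N; last by lia.
apply: coex_le => H uH fH; rewrite -ltnS prednK // ltn_neqAle; apply/andP; split.
  by apply/eqP => e; apply: hn; exists H.
apply: (leq_bigmax_cond (P := fun H => uniform r H && `[< family_free F H >])).
by rewrite uH; apply/asboolP.
Qed.

Section CoexDensity.
Variables (R : realType) (r : nat) (F : set (r_graph r)).
Hypothesis r0 : (0 < r)%N.

Definition coex_density (n : nat) : R := (coex F n)%:R / n%:R.

Lemma coex_density_ge0 n : 0 <= coex_density n.
Proof. by rewrite divr_ge0. Qed.

Lemma coex_density_le1 n : coex_density n <= 1.
Proof.
case: n => [|n]; first by rewrite /coex_density invr0 mulr0.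
by rewrite ler_pdivrMr ?ltr0n // mul1r ler_nat coex_le_n.
Qed.

(** Sampling [m] vertices from an extremal graph on [n] vertices. The threshold on [m] depends only
    on [p] and [q], and only [n] must be large in terms of [m]. *)
Lemma coex_density_transfer (p q : R) : 0 <= q < p ->
  exists m0, forall m, (m0 <= m)%N -> exists n0, forall n, (n0 <= n)%N ->
    p <= coex_density n -> q <= coex_density m.
Proof.
move=> qp; have /andP[q0 qp'] := qp; have pp := le_lt_trans q0 qp'.
have [p1|p1] := leP p 1; last first.
  exists 0%N => m _; exists 0%N => n _ /(lt_le_trans p1).
  by rewrite ltNge coex_density_le1.
have [lam lam01 [M0 HM0]] := sampling_rate r qp p1.
exists (r + M0.+1)%N => m hm; pose M := (m - r)%N.
have mE : m = (r + M)%N by rewrite /M; lia.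
have M0M : (M0 <= M)%N by rewrite /M; lia.
have M_gt0 : (0 < M)%N by rewrite /M; lia.
have [N HN] := natr_unbounded (2 * M%:R * (r + M)%:R : R).
exists N.+1 => n hn; have n0 : (0 : R) < n%:R by rewrite ltr0n (leq_trans _ hn).
rewrite /coex_density ler_pdivlMr // => pn.
have c0 : (0 < coex F n)%N by rewrite -(ltr_nat R) (lt_le_trans _ pn) // mulr_gt0.
have [H [uH fH HE]] := coex_attained c0.
have H0 : H != set0.
  by apply/eqP => H0; move: c0; rewrite -HE H0 /min_pos_codegree eqxx.
have Hk : codegree_lower_bound r H (coex F n) by rewrite -HE -min_pos_codegreeP.
have [e eH] := set0Pn _ H0; have ce := card_edge uH eH.
pose iota (a : 'I_r) : 'I_n := enum_val (cast_ord (esym ce) a).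
have iotaI : injective iota by move=> a b /enum_val_inj/cast_ord_inj.
have iotaH : [set iota a | a : 'I_r] \in H.
  suff -> : [set iota a | a : 'I_r] = e by [].
  apply/eqP; rewrite eqEcard card_imset // card_ord ce leqnn andbT.
  by apply/fintype.subsetP => _ /imsetP[a _ ->]; exact: enum_valP.
have := @exists_sample R r M _ H r0 uH iota iotaI iotaH (coex F n) (Num.truncn (q * (r + M)%:R)) p lam M_gt0 Hk.
rewrite card_ord => /(_ pn) []//.
- by rewrite (ltW pp).
- by apply: HN; apply: ltnW.
- exact: HM0.
move=> H' [uH' H'0 [f fI fP] H'k].
have fH' : family_free F H'.
  move=> G FG [g gI gP]; apply: (fH G FG); exists (f \o g); first exact: inj_comp.
  by move=> e' /gP/fP; rewrite -imset_comp.
have := coex_ge uH' fH' H'0 H'k; rewrite -mE -(ler_nat R) => h.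
rewrite ler_pdivlMr ?ltr0n; last by rewrite mE addn_gt0 r0.
by apply: le_trans h; rewrite ltW // truncnS_gt.
Qed.

Lemma cvgn_coex_density : cvgn coex_density.
Proof.
(* [sup S] is the upper limit; [coex_density_transfer] shows that the lower limit is no smaller. *)
pose S := [set x : R | forall N, exists2 n, (N <= n)%N & x <= coex_density n]%classic.
have S0 : S 0 by move=> N; exists N => //; exact: coex_density_ge0.
have S1 : has_sup S.
  split; first by exists 0.
  by exists 1 => x /(_ 0%N)[n _ /le_trans]; apply; exact: coex_density_le1.
apply/cvg_ex; exists (sup S); apply/cvgrPdist_lt => eps eps0.
have e2 : 0 < eps / 2 by rewrite divr_gt0.
have [N1 HN1] : exists N, forall n, (N <= n)%N -> coex_density n < sup S + eps / 2.
  apply: contrapT => hN; have : S (sup S + eps / 2).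
    move=> N; apply: contrapT => h; apply: hN; exists N => n hn.
    by rewrite ltNge; apply/negP => hc; apply: h; exists n.
  by move/(ub_le_sup S1.2); rewrite gerDl leNgt e2.
have [N2 HN2] : exists N, forall n, (N <= n)%N -> sup S - eps < coex_density n.
  (* The transfer needs a nonnegative target; for a negative one, nonnegativity of the density
     suffices. *)
  have [h|h] := ltP (sup S - eps / 2) 0.
    by exists 0%N => n _; apply: lt_le_trans (coex_density_ge0 n); lra.
  have e4 : 0 < eps / 4 by rewrite divr_gt0.
  have [x Sx hx] := sup_adherent e4 S1.
  have [|m0 Hm0] := @coex_density_transfer (sup S - eps / 4) (sup S - eps / 2).
    by rewrite h /=; lra.
  exists m0 => m /Hm0[n0 Hn0]; have [n nn hn] := Sx n0.
  have : sup S - eps / 2 <= coex_density m.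
    by apply: (Hn0 n nn); apply: le_trans hn; exact: ltW.
  by apply: lt_le_trans; lra.
exists (maxn N1 N2) => // n /=; rewrite geq_max => /andP[/HN1 h1 /HN2 h2].
by rewrite ltr_norml; lra.
Qed.

(** * Bounds on the limit density *)

Lemma gamma_plus_le (x : R) :
  (forall eps, 0 < eps -> exists N, forall n, (N <= n)%N ->
     coex_density n <= x + eps) -> gamma_plus R F <= x.
Proof.
move=> h; apply/ler_addgt0Pr => eps /h[N HN].
by apply: limr_le; [exact: cvgn_coex_density|exists N].
Qed.

Lemma gamma_plus_ge (x : R) :
  (forall eps, 0 < eps -> exists N, forall n, (N <= n)%N ->
     x <= coex_density n + eps) -> x <= gamma_plus R F.
Proof.
move=> h; apply/ler_addgt0Pr => eps /h[N HN]; rewrite -lerBlDr.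
apply: limr_ge; first exact: cvgn_coex_density.
by exists N => // n /= /HN; rewrite lerBlDr.
Qed.

Lemma gamma_plus_le_codegree (x : R) : 0 <= x ->
  (forall eps : R, 0 < eps -> exists N, forall (V : finType) (H : {set {set V}}), (N <= #|V|)%N ->
    uniform r H -> family_free F H ->
    (min_pos_codegree r H)%:R <= (x + eps) * #|V|%:R) ->
  gamma_plus R F <= x.
Proof.
move=> x0 h; apply: gamma_plus_le => eps eps0; have [N HN] := h eps eps0.
exists (maxn 1 N) => n; rewrite geq_max => /andP[n0 nN].
rewrite ler_pdivrMr ?ltr0n //; apply: coex_le_real => [|H uH fH].
  by rewrite mulr_ge0 // addr_ge0 // ltW.
by have := HN _ H; rewrite card_ord; exact.
Qed.

Lemma gamma_plus_ge_divn (d w : nat) : (0 < d)%N ->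
  (forall n, (n %/ d * w <= coex F n)%N) -> w%:R / d%:R <= gamma_plus R F.
Proof.
move=> d0 h; apply: gamma_plus_ge => eps eps0.
(* Rounding [n / d] down costs at most [w], which is below [eps * n] from here on. *)
have [N HN] := natr_unbounded (w%:R / eps).
exists (maxn 1 N) => n; rewrite geq_max => /andP[n0 /HN].
rewrite ltr_pdivrMr // => hw.
have nR : (0 : R) < n%:R by rewrite ltr0n.
have dR : (0 : R) < d%:R by rewrite ltr0n.
rewrite -(ler_pM2r nR) mulrDl divfK ?gt_eqF // mulrAC ler_pdivrMr //.
have h1 : n%:R <= ((n %/ d)%:R + 1) * d%:R :> R.
  by rewrite natr1 -natrM ler_nat ltnW // ltn_ceil.
have h2 : (n %/ d)%:R * w%:R <= (coex F n)%:R :> R by rewrite -natrM ler_nat.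
have w0 : (0 : R) <= w%:R by exact: ler0n.
apply: (le_trans (ler_wpM2l w0 h1)); rewrite mulrA ler_pM2r // mulrDr mulr1.
by rewrite lerD // 1?mulrC // mulrC ltW // mulrC.
Qed.

Lemma gamma_plus_le1 : gamma_plus R F <= 1.
Proof.
apply: gamma_plus_le => eps eps0; exists 0%N => n _.
by apply: le_trans (coex_density_le1 n) _; rewrite lerDl ltW.
Qed.

Lemma gamma_plus_ge0 : 0 <= gamma_plus R F.
Proof.
apply: gamma_plus_ge => eps eps0; exists 0%N => n _.
by rewrite addr_ge0 ?coex_density_ge0 // ltW.
Qed.

Lemma gamma_plus_partite (G : r_graph r) : F G -> partite r G -> gamma_plus R F = 0.
Proof.
move=> FG pG; apply/eqP; rewrite eq_le gamma_plus_ge0 andbT.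
apply: gamma_plus_le_codegree => // eps eps0.
have [N HN] := codegree_free_partite r0 pG eps0.
by exists N => V H nN uH fH; rewrite add0r; apply: HN => //; exact: fH.
Qed.

Lemma gamma_plus_ge_partite : (forall G : r_graph r, F G -> ~ partite r G) ->
  1 / r%:R <= gamma_plus R F.
Proof.
move=> h; apply: (gamma_plus_ge_divn (w := 1) r0) => n.
by rewrite muln1 coex_ge_partite.
Qed.

Lemma gamma_plus_le_Tgraph (G : r_graph r) (t : nat) : (2 <= r)%N -> F G ->
  contained_in G (blowup r (Tgraph r) t) -> gamma_plus R F <= 1 / r%:R.
Proof.
move=> r2 FG cG; apply: gamma_plus_le_codegree => [|eps eps0]; first by rewrite divr_ge0.
have [N HN] := codegree_free_Tgraph r2 cG eps0.
by exists N => V H nN uH fH; apply: HN => //; exact: fH.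
Qed.

Lemma gamma_plus_ge_Tgraph : (2 <= r)%N ->
  (forall G : r_graph r, F G -> forall t, ~ contained_in G (blowup r (Tgraph r) t)) ->
  2 / (2 * r%:R - 1) <= gamma_plus R F.
Proof.
move=> r2 h; have -> : 2 * r%:R - 1 = ((2 * r).-1)%:R :> R.
  by rewrite -subn1 natrB ?natrM //; lia.
by apply: gamma_plus_ge_divn => [|n]; [lia|exact: coex_ge_Tgraph].
Qed.

End CoexDensity.

Theorem theorem2p1 (R : realType) (r : nat) (hr : (2 <= r)%N) :
  (forall F : set (r_graph r),
     [\/ gamma_plus R F = 0, gamma_plus R F = 1 / r%:R
       | 2 / (2 * r%:R - 1) <= gamma_plus R F <= 1]) /\
  (forall alpha : R, 0 <= alpha < 2 / (2 * r%:R - 1) ->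
     gamma_plus_jump r alpha) /\
  (forall F : set (r_graph r),
     (gamma_plus R F = 0 <-> exists2 G : r_graph r, F G & partite r G) /\
     (gamma_plus R F = 1 / r%:R <->
        (forall G : r_graph r, F G -> ~ partite r G) /\
        (exists2 G : r_graph r, F G &
           exists t : nat, contained_in G (blowup r (Tgraph r) t)))).
Proof.
have r0 : (0 < r)%N by apply: ltnW.
have rR : (2 : R) <= r%:R by rewrite ler_nat.
have r_inv0 : (0 : R) < 1 / r%:R by rewrite divr_gt0 // ltr0n.
have r_inv1 : 1 / r%:R < 2 / (2 * r%:R - 1) :> R.
  by rewrite ltr_pdivrMr ?ltr0n // mulrAC ltr_pdivlMr; lra.
have top1 : 2 / (2 * r%:R - 1) < 1 :> R by rewrite ltr_pdivrMr; lra.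
(* These two properties determine which of the three ranges contains the value; since
   [0 < 1 / r < 2 / (2 * r - 1)] the ranges are disjoint, which gives the converse implications. *)
pose has_partite (F : set (r_graph r)) := exists2 G : r_graph r, F G & partite r G.
pose has_T (F : set (r_graph r)) := exists2 G : r_graph r, F G &
  exists t : nat, contained_in G (blowup r (Tgraph r) t).
have zero F : has_partite F -> gamma_plus R F = 0.
  by case=> G; exact: gamma_plus_partite.
have inv_r F : ~ has_partite F -> has_T F -> gamma_plus R F = 1 / r%:R.
  move=> nP [G FG [t cG]]; apply/eqP.
  rewrite eq_le (gamma_plus_le_Tgraph R r0 hr FG cG) gamma_plus_ge_partite //.
  by move=> G' FG' pG'; apply: nP; exists G'.
have large (F : set (r_graph r)) : ~ has_T F -> 2 / (2 * r%:R - 1) <= gamma_plus R F.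
  move=> nT; apply: gamma_plus_ge_Tgraph => // G FG t cG.
  by apply: nT; exists G => //; exists t.
have cases (F : set (r_graph r)) : [\/ gamma_plus R F = 0, gamma_plus R F = 1 / r%:R
       | 2 / (2 * r%:R - 1) <= gamma_plus R F <= 1].
  have [/zero|nP] := pselect (has_partite F); first by constructor 1.
  have [/(inv_r F nP)|/large h] := pselect (has_T F); first by constructor 2.
  by constructor 3; rewrite h gamma_plus_le1.
split=> //; split=> [alpha /andP[a0 a1]|F].
  split; first by rewrite a0 (lt_trans a1).
  (* In each case [delta] is the distance from [alpha] to the threshold above it, [1 / r] or
     [2 / (2 * r - 1)]. *)
  have [ar|ar] := ltP alpha (1 / r%:R).
    exists (1 / r%:R - alpha) => [|F]; first by rewrite subr_gt0 ar ltrD2r (lt_trans r_inv1).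
    by rewrite addrC subrK; case: (cases F) => [->|->|/andP[h _]] /andP[]; lra.
  exists (2 / (2 * r%:R - 1) - alpha) => [|F]; first by rewrite subr_gt0 a1 ltrD2r.
  by rewrite addrC subrK; case: (cases F) => [->|->|/andP[h _]] /andP[]; lra.
split; split=> [g0|]; first 1 last.
- exact: zero.
- have nP : ~ has_partite F by move/zero; lra.
  split=> [G FG pG|]; first by apply: nP; exists G.
  by apply: contrapT => /large; lra.
- case=> nP hT; apply: inv_r => // -[G FG]; exact: nP.
apply: contrapT => nP; have [hT|/large] := pselect (has_T F); last by lra.
by have := inv_r F nP hT; lra.
Qed.
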